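(* There is an absolute constant $c>0$ such that for every integer $m \geq 3$ there is $K=K(m)$ such that for every $0<\gamma\leq 1$ and for every $n$-vertex $3$-graph $G$, if $s(G;m)<c m^3$ then $G$ contains a vertex set $S$ with $|S| \geq \gamma^{K} n$ such that $S$ has density at most $\gamma$ or at least $1-\gamma$.
   Context: A $3$-graph is a $3$-uniform hypergraph. An $(m,f)$-subset of $G$ is a set of $m$ vertices of $G$ inducing exactly $f$ edges. For a $3$-graph $G$ and $m \geq 3$, $s(G;m)$ denotes the number of integers $0 \leq f \leq \binom{m}{3}$ such that $G$ contains an $(m,f)$-subset. The density of a vertex set $S$ is the number of edges of $G$ inside $S$ divided by $\binom{|S|}{3}$; that $S$ has density at most $\gamma$ (resp. at least $1-\gamma$) means that the number of edges inside $S$ is at most $\gamma\binom{|S|}{3}$ (resp. at least $(1-\gamma)\binom{|S|}{3}$). *)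

(* Defs.v *)
From mathcomp Require Import all_boot all_order all_algebra.
From mathcomp Require Import reals exp.

Set Implicit Arguments.
Unset Strict Implicit.
Unset Printing Implicit Defensive.

Import Order.TTheory GRing.Theory Num.Theory.

Local Open Scope ring_scope.

Record three_graph (V : finType) := ThreeGraph {
  edges :> {set {set V}};
  edges_card3 : forall e : {set V}, e \in edges -> #|e| = 3%N
}.

Definition num_edges (V : finType) (G : three_graph V) (S : {set V}) : nat :=
  #|[set e in edges G | e \subset S]|.

Definition mf_subset (V : finType) (G : three_graph V) (m f : nat)
    (S : {set V}) : bool :=
  (#|S| == m) && (num_edges G S == f).

(* s(G; m); the index type 'I_('C(m, 3).+1) is the range 0 <= f <= 'C(m, 3). *)
Definition num_sizes (V : finType) (G : three_graph V) (m : nat) : nat :=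
  #|[set f : 'I_('C(m, 3)).+1 | [exists S : {set V}, mf_subset G m f S]]|.

(* Stated without division, so that both conditions hold vacuously
   when #|S| < 3. *)
Definition density_le (R : realType) (V : finType) (G : three_graph V)
    (S : {set V}) (gamma : R) : Prop :=
  (num_edges G S)%:R <= gamma * ('C(#|S|, 3))%:R.

Definition density_ge (R : realType) (V : finType) (G : three_graph V)
    (S : {set V}) (gamma : R) : Prop :=
  gamma * ('C(#|S|, 3))%:R <= (num_edges G S)%:R.

(* Main.v *)
Require Import Defs.
From mathcomp Require Import all_boot all_order all_algebra.
From mathcomp Require Import reals exp.
From mathcomp Require Import zify ring lra.

(** For [gamma > 1/2] the whole vertex set has one of the two densities, and a
    set of two vertices is enough when [gamma ^ K * n <= 2].  Otherwise suppose
    that every set of at least [gamma ^ K * n] vertices has density strictly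
    between [gamma] and [1 - gamma].  Then [G] contains a configuration whose
    [m]-subsets realise at least [(m / 192) ^ 3] different numbers of edges.

    Blocks.  By double counting ([dense_star], [kst3]) such a set contains, if it
    is polynomially large in [1 / gamma], both a complete and an empty
    tripartite pattern with parts of a prescribed size; together they form a
    block.  Blocks are chosen one after the other, each inside a set on
    which every pair of earlier vertices has constant adjacency
    ([blocks_exist]).  Hence adjacency of a triple does not depend on which
    vertex of its last block is used.  Two applications of Ramsey's theorem
    ([uniform_system]) make adjacency depend only on the order type of the three
    block positions and on the labels inside the blocks, and, for labels taken
    in different letters (intervals of labels), only on the letters.

    Gadgets.  Let three clusters of vertices, with labels in three letters, each
    have two possible positions, and let [e] record whether the three clusters
    span all or no triples.  If the alternating sum of [e] over the eight
    choices of positions is nonzero, put copies of the clusters side by side,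
    with the four choices of even parity in one state and the four choices of
    odd parity in the other.  All contributions that involve at most two of the
    three choices cancel in the difference of the two states; using each choice
    twice, in a palindrome, also cancels the effect of the order of the copies.  So switching the state
    changes the number of edges by a constant times the product of the three
    cluster sizes, whatever else is in the configuration ([words_flip]).  With
    products [1, 2, 4, ...] the states write numbers in binary ([digits_sum]),
    at a total cost proportional to the cube root of the largest number, and
    this yields the required sizes ([many_sizes]).

    Why some alternating sum is nonzero ([nonzero_alt_sum]).  Otherwise, moving
    clusters among distinct positions shows that triples in three different
    blocks are all edges or all non-edges, say with indicator [s].  Moving
    clusters away from a common block shows that for letters [p, q, r] in one
    block the indicator of [pqr] satisfies [h + 2 s = t pq + t pr + t qr], where
    [t pq] is the adjacency of [p] and [q] in one block with any later vertex.
    Taking for [p] and [p'] two letters of the same part forces [t pq = s],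
    hence [h = s] for every triple of parts; but the block contains both a
    complete and an empty tripartite pattern. *)

Set Implicit Arguments.
Unset Strict Implicit.
Unset Printing Implicit Defensive.

Import Order.TTheory GRing.Theory Num.Theory.

(** * Ramsey's theorem *)

(** A vertex [x] whose [r]-sets of later elements all get colour [c0] is charged
    to [c0], and the induction is on the total number of elements still wanted
    over all colours; this replaces the usual pigeonhole on an
    end-homogeneous sequence. *)
Lemma ramsey (C : finType) (T : eqType) r n :
  exists N, forall (col : seq T -> C) s, N <= size s ->
  exists s' c, [/\ subseq s' s, size s' = n &
    forall u, subseq u s' -> size u = r -> col u = c].
Proof.
elim: r n => [|r IHr] n.
  exists n => col s les; exists (take n s), (col [::]); split.
  - exact: take_subseq.
  - exact: size_takel.
  - by move=> u _ /size0nil ->.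
(* [b c] is the number of elements still wanted in colour [c]. *)
suff budget k (b : {ffun C -> nat}) : \sum_c b c <= k ->
    exists N, forall (col : seq T -> C) s, N <= size s ->
    exists s' c, [/\ subseq s' s, size s' = b c &
      forall u, subseq u s' -> size u = r.+1 -> col u = c].
  have [N HN] := budget _ [ffun=> n] (leqnn _).
  exists N => col s /HN => /(_ col) [s' [c []]]; rewrite ffunE => *.
  by exists s', c.
elim: k b => [|k IHk] b leb.
  exists 1 => col [|x s] // _; exists [::], (col [::]); split; first exact: sub0seq.
  - apply/esym/eqP; rewrite -leqn0 (leq_trans _ leb) //.
    by rewrite (bigD1 (col [::])) //= leq_addr.
  - by move=> u; rewrite subseq0 => /eqP ->.
pose b' c0 := [ffun c => b c - (c == c0)].
have [f Hf] : exists f : C -> nat, forall c0, 0 < b c0 ->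
    forall (col : seq T -> C) s, f c0 <= size s ->
    exists s' c, [/\ subseq s' s, size s' = b' c0 c &
      forall u, subseq u s' -> size u = r.+1 -> col u = c].
  apply: (@fin_all_exists C (fun=> nat) (fun c0 N => 0 < b c0 ->
    forall (col : seq T -> C) s, N <= size s ->
    exists s' c, [/\ subseq s' s, size s' = b' c0 c &
      forall u, subseq u s' -> size u = r.+1 -> col u = c])) => c0; case: (posnP (b c0)) => [_|b0]; first by exists 0.
  have [|N HN] := IHk (b' c0); last by exists N.
  rewrite -ltnS (leq_trans _ leb) //.
  rewrite (bigD1 c0) //= [X in _ < X](bigD1 c0) //= ffunE eqxx -addSn.
  apply: leq_add; first by rewrite subn1 prednK.
  by apply: leq_sum => c /negPf nc; rewrite ffunE nc subn0.
have [N HN] := IHr (\max_c f c).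
exists N.+1 => col [|x s] //; rewrite /= ltnS => /HN => /(_ (fun u => col (x :: u))).
case=> s1 [c0 [sub1 sz1 hom1]].
case: (posnP (b c0)) => [b0|b0].
  exists [::], c0; split; [by [] | by rewrite b0 |].
  by move=> u; rewrite subseq0 => /eqP ->.
have le1 : f c0 <= size s1 by rewrite sz1; exact: leq_bigmax.
have [s' [c [sub' sz' hom']]] := Hf c0 b0 col s1 le1.
case: (eqVneq c c0) => [ec|nc].
  exists (x :: s'), c0; split.
  - by rewrite /= eqxx (subseq_trans sub').
  - by rewrite /= sz' ec ffunE eqxx subn1 prednK.
  - move=> [|y u] //=; case: eqP => [-> subu [szu]|_ subu szu].
      by apply: hom1 => //; apply: subseq_trans subu sub'.
    by rewrite -ec; apply: hom'.
exists s', c; split => //.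
- by apply: subseq_trans sub' (subseq_trans sub1 (subseq_cons _ _)).
- by rewrite sz' ffunE (negPf nc) subn0.
Qed.

Lemma nth_subseq3 (T : eqType) (x0 : T) s i j k : i < j -> j < k -> k < size s ->
  subseq [:: nth x0 s i; nth x0 s j; nth x0 s k] s.
Proof.
move=> ij jk ks.
have H a b u : a <= b -> b < size s -> subseq u (drop b.+1 s) ->
    subseq (nth x0 s b :: u) (drop a s).
  move=> ab bs sub; apply: (@subseq_trans _ (drop b s)).
    by rewrite (drop_nth x0) //= eqxx.
  by rewrite -(subnK ab) -drop_drop drop_subseq.
rewrite -[X in subseq _ X]drop0; apply: (H) => //; first by lia.
apply: (H) => //; first by lia.
by apply: (H) => //; exact: sub0seq.
Qed.

Lemma ramsey3 (C : finType) n :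
  exists N, forall col : nat -> nat -> nat -> C, exists g : nat -> nat,
  [/\ forall i j, i < j -> j < n -> g i < g j, forall i, i < n -> g i < N &
   exists c, forall i j k, i < j -> j < k -> k < n -> col (g i) (g j) (g k) = c].
Proof.
have [N HN] := ramsey C nat 3 n.
exists N => col.
have [|s [c [sub sz hom]]] :=
  HN (fun u => col (nth 0 u 0) (nth 0 u 1) (nth 0 u 2)) (iota 0 N).
  by rewrite size_iota.
have srt : sorted ltn s by apply: subseq_sorted sub (iota_ltn_sorted 0 N); exact: ltn_trans.
exists (nth 0 s); split.
- move=> i j ij jn; apply: (sorted_ltn_nth ltn_trans) => //; rewrite inE sz //.
  exact: ltn_trans jn.
- move=> i il; have := mem_nth 0 (_ : i < size s); rewrite sz => /(_ il) /(mem_subseq sub).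
  by rewrite mem_iota.
- exists c => i j k ij jk kn.
  by apply: (hom [:: nth 0 s i; nth 0 s j; nth 0 s k]) => //;
     apply: nth_subseq3; rewrite ?sz.
Qed.

(** * Complete tripartite patterns in dense sets *)

Section TripartitePatterns.
Local Open Scope ring_scope.

Lemma ffact_lower (R : realFieldType) (e : R) d n t : 0 <= e -> (t <= d)%N ->
  (forall j, (j < t)%N -> e * (n - j)%:R <= (d - j)%:R) ->
  e ^+ t * (n ^_ t)%:R <= (d ^_ t)%:R.
Proof.
move=> e0; elim: t => [|t IHt] td le; first by rewrite expr0 !ffactn0 mul1r.
rewrite !ffactnSr !natrM exprSr mulrACA.
apply: ler_pM; rewrite ?mulr_ge0 ?exprn_ge0 //; last exact: le.
apply: IHt; first exact: ltnW.
by move=> j jt; apply: le; rewrite ltnS ltnW.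
Qed.

Lemma bin_lower (R : realFieldType) (e : R) d n t : 0 <= e -> (t <= d)%N ->
  (forall j, (j < t)%N -> e * (n - j)%:R <= (d - j)%:R) ->
  e ^+ t * ('C(n, t))%:R <= ('C(d, t))%:R.
Proof.
move=> e0 td le; have := ffact_lower e0 td le.
rewrite -!bin_ffact !natrM mulrA ler_pM2r //.
by rewrite ltr0n fact_gt0.
Qed.

Lemma expr_natr_le1 (R : realFieldType) (g : R) t : 0 < g -> g <= 2^-1 ->
  g ^+ t * t.+1%:R <= 1.
Proof.
move=> g0 gh; apply: (@le_trans _ _ (2^-1 ^+ t * 2 ^+ t)); last first.
  by rewrite -exprMn mulVf ?expr1n // pnatr_eq0.
apply: ler_pM; rewrite ?exprn_ge0 ?ler0n //; first exact: ltW.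
  by apply: lerXn2r; rewrite ?nnegrE ?invr_ge0 ?ler0n // ltW.
by rewrite -natrX ler_nat ltn_expl.
Qed.

(** Double counting of the pairs of a [t]-subset of [A] and a common neighbour
    in [B].  At least a proportion [g ^ a / 2] of the vertices of [B] have degree at
    least [g ^ a * #|A| / 2], and each of them is joined to a proportion
    [(g ^ a / 4) ^ t] of the [t]-subsets.  As [g <= 1/2], the constants are
    absorbed into powers of [g]; the exponents do not depend on the sets. *)
Lemma dense_star (R : realFieldType) (X Y : finType) (A : {set X}) (B : {set Y})
    (r : X -> Y -> bool) (t a : nat) (g : R) :
  0 < g -> g <= 2^-1 -> 1 <= g ^+ (a + t + 2) * #|A|%:R ->
  g ^+ a * #|A|%:R * #|B|%:R <= (\sum_(x in A) \sum_(y in B) r x y)%:R ->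
  exists T : {set X}, [/\ T \subset A, #|T| = t &
    g ^+ (a + 1 + (a + 2) * t) * #|B|%:R
      <= #|[set y in B | [forall x in T, r x y]]|%:R].
Proof.
move=> g0 gh big dens.
pose n := #|A|; pose deg y := #|[set x in A | r x y]|.
have g1 : g <= 1 by lra.
pose dl := g ^+ a; have dl0 : 0 < dl by rewrite exprn_gt0.
have dl1 : dl <= 1 by apply: exprn_ile1 => //; exact: ltW.
have n0 : 0 < n%:R :> R.
  by rewrite ltr0n lt0n; apply/eqP => n0; move: big; rewrite -/n n0 mulr0; lra.
have g2 : g ^+ 2 <= 4^-1.
  rewrite expr2; apply: (@le_trans _ _ (2^-1 * 2^-1)); last by lra.
  by apply: ler_pM => //; exact: ltW.
have tn : 4 * t%:R <= dl * n%:R.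
  have gt : 0 < g ^+ t by rewrite exprn_gt0.
  have h : 1 <= 4^-1 * (g ^+ t * (dl * n%:R)).
    apply: le_trans big _; rewrite !exprD -/dl -/n.
    have -> : dl * g ^+ t * g ^+ 2 * n%:R = g ^+ 2 * (g ^+ t * (dl * n%:R)) by ring.
    by apply: ler_wpM2r => //; rewrite !mulr_ge0 // ltW.
  have h2 := expr_natr_le1 t g0 gh; rewrite -natr1 in h2.
  rewrite -(ler_pM2l gt); lra.
have degn y : (deg y <= n)%N by apply/subset_leq_card/subsetP => x; rewrite inE => /andP[].
have dens' : dl * n%:R * #|B|%:R <= (\sum_(y in B) deg y)%:R.
  apply: le_trans dens _; rewrite ler_nat exchange_big /=.
  by apply: leq_sum => y _; rewrite /deg -sum1dep_card big_mkcondr /=;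
     apply: leq_sum => x _; case: (r x y).
pose B' := [set y in B | dl * n%:R / 2 <= (deg y)%:R].
have B'B : dl / 2 * #|B|%:R <= #|B'|%:R.
  have : \sum_(y in B) (deg y)%:R <= n%:R * #|B'|%:R + dl * n%:R / 2 * #|B|%:R :> R.
    rewrite (big_setID B') /=; apply: lerD.
      rewrite (setIidPr _); last by apply/subsetP => y; rewrite inE => /andP[].
      rewrite mulr_natr -sumr_const; apply: ler_sum => y _; by rewrite ler_nat.
    apply: (@le_trans _ _ (\sum_(y in B :\: B') dl * n%:R / 2)).
      apply: ler_sum => y; rewrite !inE => /andP[+ yB]; rewrite yB /= -ltNge => /ltW //.
    rewrite sumr_const -[X in X <= _]mulr_natr; apply: ler_wpM2l.
      by rewrite divr_ge0 // mulr_ge0 // ltW.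
    by rewrite ler_nat; exact/subset_leq_card/subsetDl.
  rewrite -natr_sum => /(le_trans dens') h.
  rewrite -(ler_pM2l n0); lra.
pose e := dl / 4.
have e0 : 0 <= e by rewrite divr_ge0 // ltW.
have binB' y : y \in B' -> e ^+ t * ('C(n, t))%:R <= ('C(deg y, t))%:R.
  rewrite inE => /andP[_ dy].
  have td : (t <= deg y)%N.
    by rewrite -(ler_nat R); have : 0 <= t%:R :> R by []; lra.
  apply: bin_lower => // j jt.
  have jt' : j%:R <= t%:R :> R by rewrite ler_nat ltnW.
  have jd : (j <= deg y)%N by apply: leq_trans td; apply: ltnW.
  rewrite [X in _ <= X]natrB // /e.
  apply: (@le_trans _ _ (dl / 4 * n%:R)); last by lra.
  by rewrite ler_wpM2l // ler_nat leq_subr.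
pose N (T : {set X}) := [set y in B | [forall x in T, r x y]].
pose D := [set T : {set X} | T \subset A & #|T| == t].
have cD : #|D| = 'C(n, t) by rewrite cards_draws.
have double : (\sum_(T in D) #|N T| = \sum_(y in B) 'C(deg y, t))%N.
  transitivity (\sum_(T in D) \sum_(y in B) [forall x in T, r x y])%N.
    apply: eq_bigr => T _; rewrite /N -sum1dep_card big_mkcondr /=.
    by apply: eq_bigr => y _; case: [forall x in T, _].
  rewrite exchange_big /=; apply: eq_bigr => y _.
  rewrite /deg -cards_draws -sum1dep_card big_mkcond [RHS]big_mkcond /=.
  apply: eq_bigr => T _; rewrite !inE.
  case: eqP => _; rewrite ?andbF // !andbT.
  have -> : (T \subset [set x in A | r x y]) = (T \subset A) && [forall x in T, r x y].
    apply/subsetP/andP => [h|[/subsetP h1 /forall_inP h2] x xT].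
      split; first by apply/subsetP => x /h; rewrite inE => /andP[].
      by apply/forall_inP => x /h; rewrite inE => /andP[].
    by rewrite inE h1 //= h2.
  by case: (T \subset A) => //=; case: [forall x in T, _].
have Cn0 : (0 < 'C(n, t))%N.
  have dn : dl * n%:R <= n%:R by rewrite ler_piMl // ltW.
  by rewrite bin_gt0 -(ler_nat R); have : 0 <= t%:R :> R by []; lra.
have ge : g ^+ (a + 1 + (a + 2) * t) <= dl / 2 * e ^+ t.
  rewrite exprD exprM; apply: ler_pM.
  - by rewrite exprn_ge0 // ltW.
  - by rewrite !exprn_ge0 // ltW.
  - by rewrite exprD expr1 ler_pM2l.
  - apply: lerXn2r; rewrite ?nnegrE ?exprn_ge0 //; first exact: ltW.
    by rewrite exprD ler_pM2l.
case: (boolP [exists T in D, g ^+ (a + 1 + (a + 2) * t) * #|B|%:R <= #|N T|%:R]).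
  case/exists_inP => T; rewrite inE => /andP[TA /eqP cT] hT.
  by exists T.
rewrite negb_exists_in => /forall_inP noT.
have D0 : exists T, T \in D by apply/set0Pn; rewrite -card_gt0 cD.
have : \sum_(T in D) (#|N T|)%:R < \sum_(T in D) g ^+ (a + 1 + (a + 2) * t) * #|B|%:R :> R.
  have [T0 T0D] := D0; rewrite (bigD1 T0) //= [X in _ < X](bigD1 T0) //=.
  apply: ltr_leD; first by rewrite ltNge noT.
  by apply: ler_sum => T /andP[TD _]; apply: ltW; rewrite ltNge noT.
rewrite -natr_sum double sumr_const cD -[X in _ < X]mulr_natr natr_sum => lt.
have : \sum_(y in B') e ^+ t * ('C(n, t))%:R <= \sum_(y in B) ('C(deg y, t))%:R :> R.
  rewrite [X in _ <= X](big_setID B') /= (setIidPr _); last first.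
    by apply/subsetP => y; rewrite inE => /andP[].
  by rewrite -[X in X <= _]addr0; apply: lerD; [exact: ler_sum | exact: sumr_ge0].
rewrite sumr_const -[X in X <= _]mulr_natr => /le_lt_trans /(_ lt).
rewrite ltNge; case/negP; rewrite [X in _ <= X]mulrAC ler_pM2r; last by rewrite ltr0n.
apply: (@le_trans _ _ (dl / 2 * e ^+ t * #|B|%:R)); first by apply: ler_wpM2r.
by rewrite mulrAC [X in _ <= X]mulrC; apply: ler_wpM2r => //; rewrite exprn_ge0.
Qed.

(** Erdos's theorem for tripartite 3-graphs: [dense_star] fixes one part at a
    time, first against pairs of vertices, then against single vertices; the
    third part is taken in what is left. *)
Lemma kst3 t : exists C : nat, forall (R : realFieldType) (g : R) (V : finType)
    (f : V -> V -> V -> bool) (W : {set V}),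
  0 < g -> g <= 2^-1 -> 1 <= g ^+ C * #|W|%:R ->
  g ^+ 2 * #|W|%:R ^+ 3
    <= (\sum_(x in W) \sum_(y in W) \sum_(z in W) f x y z)%:R ->
  exists T1 T2 T3 : {set V},
  [/\ [/\ T1 \subset W, T2 \subset W & T3 \subset W],
      [/\ #|T1| = t, #|T2| = t & #|T3| = t] &
      forall x y z, x \in T1 -> y \in T2 -> z \in T3 -> f x y z].
Proof.
pose a1 := (2 + 1 + (2 + 2) * t)%N.
pose a2 := (a1 + 1 + (a1 + 2) * t)%N.
exists (a2 + t + 2)%N => R g V f W g0 gh big dens.
have g1 : g <= 1 by lra.
have big' k : (k <= a2 + t + 2)%N -> 1 <= g ^+ k * #|W|%:R.
  move=> kC; apply: le_trans big _; apply: ler_wpM2r => //.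
  by apply: ler_wiXn2l => //; exact: ltW.
have a12 : (a1 <= a2)%N by rewrite /a2 -addnA leq_addr.
have [||T1 [T1W cT1 N1]] := @dense_star R V (V * V)%type W (setX W W)
  (fun x yz => f x yz.1 yz.2) t 2 g g0 gh.
- by apply: big'; rewrite /a2 /a1; lia.
- have -> : g ^+ 2 * #|W|%:R * #|setX W W|%:R = g ^+ 2 * #|W|%:R ^+ 3 :> R.
    by rewrite cardsX natrM; ring.
  apply: le_trans dens _; rewrite ler_nat; apply: leq_sum => x _.
  rewrite pair_big /= leq_eqVlt; apply/orP; left; apply/eqP.
  by apply: eq_bigl => -[y z]; rewrite in_setX.
have [||T2 [T2W cT2 N2]] := @dense_star R V V W W
  (fun y z => [forall x in T1, f x y z]) t a1 g g0 gh.
- by apply: big'; lia.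
- move: N1; rewrite cardsX natrM mulrA => /le_trans; apply.
  rewrite ler_nat pair_big_dep /= -sum1dep_card big_mkcond [X in (_ <= X)%N]big_mkcond /=.
  apply: leq_sum => -[y z] _ /=; rewrite !inE /=.
  by case: ((y \in W) && (z \in W)) => //=; case: [forall x in T1, _].
set U := [set y in W | _] in N2.
have tU : (t <= #|U|)%N.
  rewrite -(ler_nat R); apply: le_trans N2; rewrite -/a2.
  have gt : 0 < g ^+ t by rewrite exprn_gt0.
  rewrite -(ler_pM2l gt); apply: (@le_trans _ _ (g ^+ t * t.+1%:R)).
    by rewrite ler_pM2l // ler_nat.
  apply: le_trans (expr_natr_le1 t g0 gh) _.
  by rewrite mulrA -exprD; apply: big'; lia.
have [T3 T3U cT3] : exists2 T3 : {set V}, T3 \subset U & #|T3| = t.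
  have /card_gt0P [T3] : (0 < #|[set T : {set V} | T \subset U & #|T| == t]|)%N.
    by rewrite cards_draws bin_gt0.
  by rewrite inE => /andP[sub /eqP c]; exists T3.
exists T1, T2, T3; split => //.
  by split => //; apply: subset_trans T3U _; apply/subsetP => z; rewrite inE => /andP[].
move=> x y z xT yT /(subsetP T3U); rewrite inE => /andP[_ /forall_inP /(_ y yT)].
by move=> /forall_inP; apply.
Qed.

End TripartitePatterns.

(** * Ordered triples and blocks *)

Lemma cards3 (V : finType) (x y z : V) :
  #|[set x; y; z]| = 3 <-> [/\ x != y, x != z & y != z].
Proof.
rewrite setUC cardsU1 cards2 !inE negb_or ![z == _]eq_sym.
by case: (x == y); case: (x == z); case: (y == z); split => //; case.
Qed.

Lemma set3_eq (V : finType) (e : {set V}) x y z : #|e| = 3 ->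
  ([set x; y; z] == e) = [&& x \in e, y \in e :\ x & z \in e :\ x :\ y].
Proof.
move=> ce; apply/eqP/and3P => [defe|[xe ye ze]].
  have [] := (cards3 x y z).1 _; first by rewrite defe.
  rewrite -defe !inE !eqxx !orbT /= => xy xz yz.
  by rewrite eq_sym xy eq_sym yz eq_sym xz.
move: ye ze; rewrite !inE => /andP[yx ye] /and3P[zy zx ze].
apply/eqP; rewrite eqEcard ce.
rewrite (_ : #|[set x; y; z]| = 3) ?andbT; last by apply/cards3; rewrite !(eq_sym _ y) yx !(eq_sym _ z) zy zx.
by apply/subsetP => v; rewrite !inE => /orP[/orP[]|] /eqP ->.
Qed.

Lemma sum_set3 (V : finType) (e : {set V}) : #|e| = 3 ->
  \sum_x \sum_y \sum_z ([set x; y; z] == e) = 6.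
Proof.
move=> ce.
transitivity (\sum_(x in e) \sum_(y in e :\ x) \sum_(z in e :\ x :\ y) 1).
  rewrite [RHS]big_mkcond /=; apply: eq_bigr => x _.
  case: ifP => xe; last first.
    by rewrite big1 // => y _; rewrite big1 // => z _; rewrite set3_eq // xe.
  rewrite [RHS]big_mkcond /=; apply: eq_bigr => y _.
  case: ifP => ye; last by rewrite big1 // => z _; rewrite set3_eq // ye andbF.
  rewrite [RHS]big_mkcond /=; apply: eq_bigr => z _.
  by rewrite set3_eq // xe ye /=; case: (z \in _).
transitivity (\sum_(x in e) 2); last by rewrite sum_nat_const ce.
apply: eq_bigr => x xe.
have cx : #|e :\ x| = 2 by have := cardsD1 x e; rewrite xe ce => -[].
transitivity (\sum_(y in e :\ x) 1); last by rewrite sum_nat_const cx.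
apply: eq_bigr => y ye.
by rewrite sum1_card; have := cardsD1 y (e :\ x); rewrite ye cx => -[].
Qed.

(** Each edge inside [S] is counted once for each of its six orderings; all
    edge counts below are computed as such ordered sums. *)
Lemma sum_triples (V : finType) (E : {set {set V}}) (S : {set V}) :
  (forall e, e \in E -> #|e| = 3) ->
  \sum_(x in S) \sum_(y in S) \sum_(z in S) ([set x; y; z] \in E)
    = 6 * #|[set e in E | e \subset S]|.
Proof.
move=> E3; set ES := [set e in E | e \subset S].
transitivity (\sum_(e in ES) \sum_x \sum_y \sum_z ([set x; y; z] == e)); last first.
  rewrite (eq_bigr (fun=> 6)); first by rewrite sum_nat_const mulnC.
  by move=> e; rewrite inE => /andP[/E3 /sum_set3].
rewrite [RHS]exchange_big [LHS]big_mkcond /=; apply: eq_bigr => x _.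
rewrite [RHS]exchange_big /=.
case: ifP => xS; last first.
  rewrite big1 // => y _; rewrite exchange_big /= big1 // => z _; rewrite big1 // => e.
  rewrite inE => /andP[_ /subsetP eS]; case: eqP => // defe.
  by move: xS; rewrite eS // -defe !inE eqxx.
rewrite [LHS]big_mkcond; apply: eq_bigr => y _; rewrite [RHS]exchange_big /=.
case: ifP => yS; last first.
  rewrite big1 // => z _; rewrite big1 // => e.
  rewrite inE => /andP[_ /subsetP eS]; case: eqP => // defe.
  by move: yS; rewrite eS // -defe !inE eqxx orbT.
rewrite [LHS]big_mkcond; apply: eq_bigr => z _.
case: ifP => zS; last first.
  rewrite big1 // => e.
  rewrite inE => /andP[_ /subsetP eS]; case: eqP => // defe.
  by move: zS; rewrite eS // -defe !inE eqxx orbT.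
case: (boolP (_ \in E)) => xyz.
  rewrite (bigD1 [set x; y; z]) /=; last first.
    by rewrite inE xyz; apply/subsetP => v; rewrite !inE => /orP[/orP[]|] /eqP ->.
  rewrite eqxx big1 // => e /andP[_ ne].
  by rewrite eq_sym (negPf ne).
rewrite big1 // => e; rewrite inE => /andP[eE _].
by case: eqP => // defe; rewrite defe eE in xyz.
Qed.

Section Blocks.

(** The label [(b, j, x)] is the [x]-th vertex of the [j]-th part of the
    complete ([b = true]) or empty ([b = false]) pattern of a block. *)
Definition block_label t : finType := (bool * 'I_3 * 'I_t)%type.

Variables (V : finType) (E : {set {set V}}).

Definition edge x y z := [set x; y; z] \in E.

Lemma edge12 x y z : edge x y z = edge y x z.
Proof. by rewrite /edge [[set x; y]]setUC. Qed.

Lemma edge23 x y z : edge x y z = edge x z y.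
Proof. by rewrite /edge setUAC. Qed.

Definition block t (q : block_label t -> V) :=
  injective q /\
  forall b x y z, edge (q (b, 0%R, x)) (q (b, 1%R, y)) (q (b, 2%:R%R, z)) = b.

(** All that is used of the density hypothesis: both patterns, with parts of size
    [t], occur in every large set of vertices. *)
Definition rich t N := forall b (W : {set V}), N <= #|W| ->
  exists T : 'I_3 * 'I_t -> V, [/\ injective T, forall l, T l \in W &
    forall x y z, edge (T (0%R, x)) (T (1%R, y)) (T (2%:R%R, z)) = b].

Lemma rich_block t N (W : {set V}) : rich t N -> N + 3 * t <= #|W| ->
  exists q : block_label t -> V, block q /\ forall l, q l \in W.
Proof.
move=> rch bigW.
have [|T1 [inj1 T1W T1E]] := rch true W; first by apply: leq_trans bigW; rewrite leq_addr.
have [|T2 [inj2 T2W T2E]] := rch false (W :\: [set T1 l | l in setT]).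
  have := leq_imset_card T1 setT; rewrite cardsT card_prod !card_ord => le.
  rewrite -(leq_add2r (3 * t)); apply: leq_trans bigW _.
  rewrite -(cardsID [set T1 l | l in setT] W) addnC leq_add2l.
  by apply: leq_trans le; apply: subset_leq_card; exact: subsetIr.
exists (fun l => if l.1.1 then T1 (l.1.2, l.2) else T2 (l.1.2, l.2)).
have dis l l' : T1 l <> T2 l'.
  by move=> eqT; have := T2W l'; rewrite -eqT inE imset_f.
split; last first.
  by move=> l; case: ifP => // _; have := T2W (l.1.2, l.2); rewrite inE => /andP[].
split; last by case.
move=> [[b j] x] [[b' j'] x'] /=.
case: b; case: b' => //= h.
- by case: (inj1 _ _ h) => -> ->.
- by case: (dis _ _ h).
- by case: (dis _ _ (esym h)).
- by case: (inj2 _ _ h) => -> ->.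
Qed.

(** The set is halved once for each pair, by the majority adjacency. *)
Lemma type_class (ps : seq (V * V)) (W : {set V}) :
  exists2 W' : {set V}, W' \subset W /\ #|W| <= 2 ^ size ps * #|W'| &
  forall a b, (a, b) \in ps -> forall z z', z \in W' -> z' \in W' ->
    edge a b z = edge a b z'.
Proof.
elim: ps => [|[a b] ps [W1 [sub1 le1] typ1]]; first by exists W; rewrite ?mul1n.
pose A := [set z in W1 | edge a b z]; pose B := W1 :\: A.
have cAB : #|W1| = #|A| + #|B|.
  rewrite -(cardsID A W1) (setIidPr _) //.
  by apply/subsetP => z; rewrite inE => /andP[].
have AW : A \subset W1 by apply/subsetP => z; rewrite inE => /andP[].
have BW : B \subset W1 by apply: subsetDl.
have [le|/ltnW le] := leqP #|B| #|A|.
  exists A; first split; first exact: subset_trans AW sub1.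
    apply: leq_trans le1 _; rewrite /= expnSr -mulnA leq_mul2l; lia.
  move=> a' b'; rewrite inE => /orP[/eqP[-> ->]|/typ1 h] z z' zA z'A.
    by move: zA z'A; rewrite !inE => /andP[_ ->] /andP[_ ->].
  by apply: h; exact: (subsetP AW).
exists B; first split; first exact: subset_trans BW sub1.
  apply: leq_trans le1 _; rewrite /= expnSr -mulnA leq_mul2l; lia.
move=> a' b'; rewrite inE => /orP[/eqP[-> ->]|/typ1 h] z z' zA z'A.
  move: zA z'A; rewrite !inE => /andP[+ zW] /andP[+ z'W].
  by rewrite zW z'W /= => /negPf -> /negPf ->.
by apply: h; exact: (subsetP BW).
Qed.

End Blocks.

(** The last clause is the point: a block is chosen inside one type class over
    the pairs of earlier vertices, so that an edge does not see which vertex of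
    its last block it uses.  It rules out structures in which different letters
    live in different global classes of vertices, for which the gadgets below
    need not exist.  The loss [A] does not depend on the graph. *)
Lemma blocks_exist t k : exists A, forall (V : finType) (E : {set {set V}}) N,
  0 < N -> rich E t N -> A * N <= #|V| ->
  exists q : nat -> block_label t -> V,
  [/\ forall i, i < k -> block E (q i),
      forall i j l l', i < k -> j < k -> q i l = q j l' -> i = j /\ l = l' &
      forall i j h l1 l2 l3 l4, i < h -> j < h -> h < k ->
        edge E (q i l1) (q j l2) (q h l3) = edge E (q i l1) (q j l2) (q h l4)].
Proof.
elim: k => [|k [A IHk]].
  exists 1 => V E N N0 rch; rewrite mul1n => leV.
  have [q _] : exists q : block_label t -> V, True.
    have [|T _] := rch true setT; first by rewrite cardsT.
    by exists (fun l => T (l.1.2, l.2)).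
  by exists (fun=> q).
pose h := k * (6 * t).
exists (A + 2 ^ (h * h) * (1 + 3 * t) + h) => V E N N0 rch leV.
have [|q [q1 q2 q3]] := IHk V E N N0 rch.
  by apply: leq_trans leV; rewrite leq_mul2r -!addnA leq_addr orbT.
pose H := [seq q i l | i <- iota 0 k, l <- enum (block_label t)].
have szH : size H = h.
  rewrite /H size_allpairs size_iota -cardE /h !card_prod card_bool !card_ord.
  by rewrite mulnA.
have [W' [sub le] typ] := type_class E [seq (a, b) | a <- H, b <- H] (~: [set x in H]).
have [|q0 [q0b q0W]] := rich_block rch (_ : N + 3 * t <= #|W'|).
  move: le; rewrite size_allpairs szH => le.
  have cH : #|[set x in H]| <= h by rewrite -szH cardsE card_size.
  have leV' : 2 ^ (h * h) * (N + 3 * t) <= #|~: [set x in H]|.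
    rewrite -(leq_add2l #|[set x in H]|) cardsC.
    apply: leq_trans leV; apply: (@leq_trans (h * N + 2 ^ (h * h) * ((1 + 3 * t) * N))).
      apply: leq_add; first by apply: leq_trans cH _; rewrite leq_pmulr.
      by rewrite leq_mul2l mulnDl mul1n leq_add2l leq_pmulr // orbT.
    by rewrite mulnA -mulnDl leq_mul2r; apply/orP; right; rewrite addnC leq_add2r leq_addl.
  by have := leq_trans leV' le; rewrite leq_pmul2l // expn_gt0.
have inH i l : i < k -> q i l \in H.
  by move=> ik; apply/allpairsP; exists (i, l); rewrite mem_iota mem_enum.
have q0H l : q0 l \notin H by have /(subsetP sub) := q0W l; rewrite !inE.
exists (fun i => if i == k then q0 else q i); split.
- move=> i; rewrite ltnS leq_eqVlt; case: eqP => [//|_] /=; exact: q1.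
- move=> i j l l'; rewrite !ltnS (leq_eqVlt i) (leq_eqVlt j).
  case: eqP => [->|_] /=; case: eqP => [->|_] //= ik jk.
  + by move=> /(proj1 q0b) ->.
  + by move=> h0; have := q0H l; rewrite h0 inH.
  + by move=> h0; have := q0H l'; rewrite -h0 inH.
  + exact: q2.
move=> i j m l1 l2 l3 l4 im jm; rewrite ltnS leq_eqVlt; case: (eqVneq m k) => [mk|_] /= mk'.
  have ik : i < k by rewrite -mk.
  have jk : j < k by rewrite -mk.
  rewrite !ltn_eqF //; apply: typ => //.
  by apply/allpairsP; exists (q i l1, q j l2); rewrite !inH.
by rewrite !ltn_eqF ?(ltn_trans _ mk') //; apply: q3.
Qed.

(** * Order-indiscernible sequences of blocks *)

(** The rank of [i] among the distinct values of [i], [j], [k].  The three ranks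
    form the canonical triple of positions below 3 with the same order type. *)
Definition rk (i j k : nat) : nat := if j == k then nat_of_bool (j < i) else (j < i) + (k < i).

Definition sel (i j k r : nat) := if r is 0 then i else if r is 1 then j else k.

Lemma rk_lt3 i j k : rk i j k < 3.
Proof. by rewrite /rk; case: ifP => _; case: (j < i); case: (k < i). Qed.

Lemma rkC i j k : rk i j k = rk i k j.
Proof. by rewrite /rk eq_sym; case: eqP => [->|_] //; exact: addnC. Qed.

Lemma eq_rk i j k i' j' k' : (j < i) = (j' < i') -> (k < i) = (k' < i') ->
  (j < k) = (j' < k') -> (k < j) = (k' < j') -> rk i j k = rk i' j' k'.
Proof. by move=> ji ki jk kj; rewrite /rk ji ki (_ : (j == k) = (j' == k')) //; lia. Qed.

Lemma rk_lt i j k : i < k -> j < k -> rk i j k < rk k i j.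
Proof.
move=> ik jk; rewrite /rk ik jk (ltn_eqF jk) (leq_gtF (ltnW ik)).
by case: (ltngtP i j).
Qed.

(** Repeated positions are completed by the two spare positions [B] and [B + 1],
    so that every order type is read off an increasing triple. *)
Lemma sort3 B i j k : i < B -> j < B -> k < B ->
  exists a b c, [/\ a < b, b < c & c < B.+2] /\
    [/\ i = sel a b c (rk i j k), j = sel a b c (rk j i k) & k = sel a b c (rk k i j)].
Proof.
move=> iB jB kB; rewrite /rk.
case: (ltngtP i j) => [ij|ji|ij]; case: (ltngtP i k) => [ik|ki|ik];
  case: (ltngtP j k) => [jk|kj|jk]; try lia.
- by exists i, j, k; rewrite /=; split; split => //; lia.
- by exists i, k, j; rewrite /=; split; split => //; lia.
- by exists i, j, B; rewrite /=; split; split => //; lia.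
- by exists k, i, j; rewrite /=; split; split => //; lia.
- by exists i, j, B; rewrite /=; split; split => //; lia.
- by exists j, i, k; rewrite /=; split; split => //; lia.
- by exists j, k, i; rewrite /=; split; split => //; lia.
- by exists k, j, i; rewrite /=; split; split => //; lia.
- by exists j, i, B; rewrite /=; split; split => //; lia.
- by exists j, i, B; rewrite /=; split; split => //; lia.
- by exists i, k, B; rewrite /=; split; split => //; lia.
- by exists k, i, B; rewrite /=; split; split => //; lia.
- by exists i, B, B.+1; rewrite /=; split; split => //; lia.
Qed.

Lemma rk_idem i j k :
  [/\ rk (rk i j k) (rk j i k) (rk k i j) = rk i j k,
      rk (rk j i k) (rk i j k) (rk k i j) = rk j i k &
      rk (rk k i j) (rk i j k) (rk j i k) = rk k i j].
Proof.
rewrite /rk; case: (ltngtP i j) => [ij|ji|ij]; case: (ltngtP i k) => [ik|ki|ik];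
  by case: (ltngtP j k) => [jk|kj|jk]; rewrite //=; lia.
Qed.

(** Ramsey's theorem for triples is applied twice: to the indices of the blocks,
    the colour of a triple of blocks being all adjacencies among them, and then
    to the labels inside parts, the colour of three labels being all
    adjacencies between the vertices they give in the first three blocks.  The
    vertex [w i p x] has position [i], part [p] and label [x]. *)
Lemma uniform_system (B n : nat) : 3 <= B -> exists t A,
  forall (V : finType) (E : {set {set V}}) N,
  0 < N -> rich E t N -> A * N <= #|V| ->
  exists w : nat -> bool * 'I_3 -> nat -> V,
  [/\ forall i j p p' x x', i < B -> j < B -> x < n -> x' < n ->
        w i p x = w j p' x' -> [/\ i = j, p = p' & x = x'],
      forall i j k p1 p2 p3 x1 x2 x3, i < B -> j < B -> k < B ->
        edge E (w i p1 x1) (w j p2 x2) (w k p3 x3) =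
        edge E (w (rk i j k) p1 x1) (w (rk j i k) p2 x2) (w (rk k i j) p3 x3),
      forall i j k p1 p2 p3 p4 x1 x2 x3 x4, i < k -> j < k -> k < B ->
        edge E (w i p1 x1) (w j p2 x2) (w k p3 x3) =
        edge E (w i p1 x1) (w j p2 x2) (w k p4 x4),
      forall i j k p1 p2 p3 x1 x2 x3 y1 y2 y3, i < 3 -> j < 3 -> k < 3 ->
        x1 < x2 -> x2 < x3 -> x3 < n -> y1 < y2 -> y2 < y3 -> y3 < n ->
        edge E (w i p1 x1) (w j p2 x2) (w k p3 x3) =
        edge E (w i p1 y1) (w j p2 y2) (w k p3 y3) &
      forall b x y z,
        edge E (w 0 (b, 0%R) x) (w 0 (b, 1%R) y) (w 0 (b, 2%:R%R) z) = b].
Proof.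
move=> B3.
have [t0 Ht] := ramsey3 {ffun ('I_3 * (bool * 'I_3)) * ('I_3 * (bool * 'I_3)) *
  ('I_3 * (bool * 'I_3)) -> bool} n.
pose t := t0.+1.
have [k0 Hk] := ramsey3 {ffun ('I_3 * block_label t) * ('I_3 * block_label t) * ('I_3 * block_label t)
  -> bool} B.+2.
have [A HA] := blocks_exist t k0.
exists t, A => V E N N0 rch bigV.
have [q [q1 q2 q3]] := HA V E N N0 rch bigV.
have [g [g1 g2 [c hc]]] := Hk (fun i j k => [ffun a : ('I_3 * block_label t) * ('I_3 * block_label t) * ('I_3 * block_label t) =>
  edge E (q (sel i j k a.1.1.1) a.1.1.2) (q (sel i j k a.1.2.1) a.1.2.2)
         (q (sel i j k a.2.1) a.2.2)]).
pose v i := q (g i).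
have gsel i j k r : g (sel i j k r) = sel (g i) (g j) (g k) r by case: r => [|[|]].
have vE i j k l1 l2 l3 : i < B -> j < B -> k < B ->
    edge E (v i l1) (v j l2) (v k l3) =
    c ((inord (rk i j k), l1), (inord (rk j i k), l2), (inord (rk k i j), l3)).
  move=> iB jB kB; have [s0 [s1 [s2 [[s01 s12 sB] [ei ej ek]]]]] := sort3 iB jB kB.
  rewrite -(hc s0 s1 s2) // ffunE /= !inordK ?rk_lt3 // -!gsel.
  by rewrite -ei -ej -ek.
have [h [h1 h2 [d hd]]] := Ht (fun x y z => [ffun a : ('I_3 * (bool * 'I_3)) * ('I_3 * (bool * 'I_3)) *
  ('I_3 * (bool * 'I_3)) =>
  edge E (v a.1.1.1 (a.1.1.2, inord x)) (v a.1.2.1 (a.1.2.2, inord y))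
         (v a.2.1 (a.2.2, inord z))]).
have gk i : i < B -> g i < k0 by move=> iB; apply: g2; lia.
have h_inj x x' : x < n -> x' < n -> h x = h x' -> x = x'.
  move=> xn x'n hx; have [lt|gt|//] := ltngtP x x'.
    by have := h1 _ _ lt x'n; rewrite hx ltnn.
  by have := h1 _ _ gt xn; rewrite hx ltnn.
have g_inj x x' : x < B -> x' < B -> g x = g x' -> x = x'.
  move=> xn x'n hx; have [lt|gt|//] := ltngtP x x'.
    by have := g1 _ _ lt (leqW (leqW x'n)); rewrite hx ltnn.
  by have := g1 _ _ gt (leqW (leqW xn)); rewrite hx ltnn.
exists (fun i p x => v i (p, inord (h x))); split.
- move=> i j p p' x x' iB jB xn x'n /q2 [||gij [-> /(congr1 val)]]; rewrite ?gk //.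
  rewrite /= !inordK ?ltnS ?(ltnW (h2 _ _)) // => hx; split => //; first exact: g_inj.
  exact: h_inj.
- move=> i j k p1 p2 p3 x1 x2 x3 iB jB kB; rewrite !vE //.
    by have [-> -> ->] := rk_idem i j k.
  1-3: exact: leq_trans (rk_lt3 _ _ _) B3.
- move=> i j k p1 p2 p3 p4 x1 x2 x3 x4 ik jk kB; apply: q3; last exact: gk.
    by apply: g1 => //; lia.
  by apply: g1 => //; lia.
- move=> i j k p1 p2 p3 x1 x2 x3 y1 y2 y3 i3 j3 k3 x12 x23 xn y12 y23 yn.
  have hE z1 z2 z3 : z1 < z2 -> z2 < z3 -> z3 < n ->
    edge E (v i (p1, inord (h z1))) (v j (p2, inord (h z2))) (v k (p3, inord (h z3)))
    = d ((inord i, p1), (inord j, p2), (inord k, p3)).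
    by move=> z12 z23 z3n; rewrite -(hd z1 z2 z3) // ffunE /= !inordK.
  by rewrite !hE.
- by move=> b x y z; apply: (proj2 (q1 _ _)); apply: gk; lia.
Qed.

(** * Switching gadgets *)

Section Gadget.
Local Open Scope ring_scope.

Variables (L : eqType) (F : nat * L -> nat * L -> nat * L -> bool).

(** A point is a position together with a label. *)
Definition order_invariant := forall i j k i' j' k' l1 l2 l3,
  (i < j)%N = (i' < j')%N -> (j < i)%N = (j' < i')%N ->
  (i < k)%N = (i' < k')%N -> (k < i)%N = (k' < i')%N ->
  (j < k)%N = (j' < k')%N -> (k < j)%N = (k' < j')%N ->
  F (i, l1) (j, l2) (k, l3) = F (i', l1) (j', l2) (k', l3).

Hypothesis F12 : forall x y z, F x y z = F y x z.
Hypothesis F23 : forall x y z, F x y z = F x z y.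
Hypothesis Find : order_invariant.

Implicit Types s Y Z : seq (nat * L).

Definition triple_sum s1 s2 s3 : int :=
  \sum_(x <- s1) \sum_(y <- s2) \sum_(z <- s3) (F x y z)%:R.

Lemma triple_sum_cat1 s s' Y Z : triple_sum (s ++ s') Y Z = triple_sum s Y Z + triple_sum s' Y Z.
Proof. by rewrite /triple_sum big_cat. Qed.

Lemma triple_sum12 s1 s2 s3 : triple_sum s1 s2 s3 = triple_sum s2 s1 s3.
Proof.
rewrite /triple_sum exchange_big; apply: eq_bigr => x _; apply: eq_bigr => y _.
by apply: eq_bigr => z _; rewrite F12.
Qed.

Lemma triple_sum23 s1 s2 s3 : triple_sum s1 s2 s3 = triple_sum s1 s3 s2.
Proof.
rewrite /triple_sum; apply: eq_bigr => x _; rewrite exchange_big; apply: eq_bigr => y _.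
by apply: eq_bigr => z _; rewrite F23.
Qed.

Lemma triple_sum_cat2 s s' Y Z : triple_sum Y (s ++ s') Z = triple_sum Y s Z + triple_sum Y s' Z.
Proof. by rewrite ![triple_sum Y _ _]triple_sum12 triple_sum_cat1. Qed.

Lemma triple_sum_cat3 s s' Y Z : triple_sum Y Z (s ++ s') = triple_sum Y Z s + triple_sum Y Z s'.
Proof. by rewrite ![triple_sum Y Z _]triple_sum23 triple_sum_cat2. Qed.

Definition triple_sum_catE := (triple_sum_cat1, triple_sum_cat2, triple_sum_cat3).

(** For a duplicate-free list of points this is six times the number of edges
    that they span. *)
Definition edge_sum s := triple_sum s s s.

Lemma edge_sum_cat s Z : edge_sum (s ++ Z) = edge_sum s + 3 * triple_sum s s Z + 3 * triple_sum s Z Z + edge_sum Z.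
Proof.
rewrite /edge_sum !triple_sum_catE (triple_sum12 Z s Z) (triple_sum23 s Z s) (triple_sum23 Z Z s) (triple_sum12 Z s Z) (triple_sum12 Z s s) (triple_sum23 s Z s).
ring.
Qed.

Lemma edge_sum_perm s s' : perm_eq s s' -> edge_sum s = edge_sum s'.
Proof.
move=> p; rewrite /edge_sum /triple_sum (perm_big _ p); apply: eq_bigr => x _.
by rewrite (perm_big _ p); apply: eq_bigr => y _; rewrite (perm_big _ p).
Qed.

Definition off a b s := all (fun x => (x.1 < a)%N || (b <= x.1)%N) s.
Definition within a b s := all (fun x => (a <= x.1)%N && (x.1 < b)%N) s.

Lemma off_sub a b a' b' s : (a <= a')%N -> (b' <= b)%N -> off a b s -> off a' b' s.
Proof. by move=> aa bb; apply: sub_all => x; lia. Qed.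

Lemma within_off a b c d s : (b <= c)%N || (d <= a)%N -> within a b s -> off c d s.
Proof. by move=> aa; apply: sub_all => x; lia. Qed.

Definition cluster p (lab : nat -> L) n : seq (nat * L) := [seq (p, lab i) | i <- iota 0 n].

(** Points outside an interval only see on which side of it a point lies. *)
Lemma triple_sum_move a b p p' lab n Y Z : (a <= p < b)%N -> (a <= p' < b)%N ->
  off a b Y -> off a b Z -> triple_sum (cluster p lab n) Y Z = triple_sum (cluster p' lab n) Y Z.
Proof.
move=> ap ap' /allP oY /allP oZ; rewrite /triple_sum !big_map; apply: eq_bigr => i _.
apply: eq_big_seq => -[j l] /oY /= hj; apply: eq_big_seq => -[k l'] /oZ /= hk.
by congr (nat_of_bool _)%:R; apply: Find; lia.
Qed.

Definition shift a s := [seq (a + x.1, x.2)%N | x <- s].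

Lemma shift_cat a s s' : shift a (s ++ s') = shift a s ++ shift a s'.
Proof. exact: map_cat. Qed.

Lemma shift_cluster a p lab n : shift a (cluster p lab n) = cluster (a + p) lab n.
Proof. by rewrite /shift /cluster -map_comp. Qed.

Lemma shift_within a s : within 0 6 s -> within a (a + 6) (shift a s).
Proof. by rewrite /within all_map; apply: sub_all => x /=; lia. Qed.

(** The shifts [a], [a'] and the shifts [b], [b'] bring intervals of length 6
    into the same relative position: equal, or disjoint in the same order. *)
Definition sep (a a' b b' : nat) :=
  [|| (a == a') && (b == b'), (a + 6 <= a')%N && (b + 6 <= b')%N
    | (a' + 6 <= a)%N && (b' + 6 <= b)%N].

Lemma triple_sum_shift a1 a2 a3 b1 b2 b3 s1 s2 s3 :
  within 0 6 s1 -> within 0 6 s2 -> within 0 6 s3 ->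
  sep a1 a2 b1 b2 -> sep a1 a3 b1 b3 -> sep a2 a3 b2 b3 ->
  triple_sum (shift a1 s1) (shift a2 s2) (shift a3 s3) = triple_sum (shift b1 s1) (shift b2 s2) (shift b3 s3).
Proof.
rewrite /sep => /allP w1 /allP w2 /allP w3 h12 h13 h23; rewrite /triple_sum !big_map.
apply: eq_big_seq => -[i l1] /w1 /= hi; rewrite !big_map.
apply: eq_big_seq => -[j l2] /w2 /= hj; rewrite !big_map.
apply: eq_big_seq => -[k l3] /w3 /= hk.
congr (nat_of_bool _)%:R; apply: Find; move: h12 h13 h23; clear -hi hj hk; lia.
Qed.

Lemma triple_sum_shift2 lo hi a b s1 s2 Z : within 0 6 s1 -> within 0 6 s2 -> off lo hi Z ->
  (lo <= a)%N -> (a + 6 <= hi)%N -> (lo <= b)%N -> (b + 6 <= hi)%N ->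
  triple_sum (shift a s1) (shift a s2) Z = triple_sum (shift b s1) (shift b s2) Z.
Proof.
move=> /allP w1 /allP w2 /allP oZ la ah lb bh; rewrite /triple_sum !big_map.
apply: eq_big_seq => -[i l1] /w1 /= hi'; rewrite !big_map.
apply: eq_big_seq => -[j l2] /w2 /= hj.
apply: eq_big_seq => -[k l3] /oZ /= hk.
congr (nat_of_bool _)%:R; apply: Find; clear -hi' hj hk la ah lb bh; lia.
Qed.

Variables (pu px py : bool -> nat) (labU labX labY : nat -> L).
Hypothesis pu6 : forall b, (pu b < 6)%N.
Hypothesis px6 : forall b, (px b < 6)%N.
Hypothesis py6 : forall b, (py b < 6)%N.

Definition word : Type := bool * bool * bool.

Section Sizes.
Variables su sx sy : nat.

(** The bits of [w] choose the position of each of the three clusters. *)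
Definition copy (w : word) :=
  cluster (pu w.1.1) labU su ++ cluster (px w.1.2) labX sx ++ cluster (py w.2) labY sy.

Lemma cluster_within p lab n : (p < 6)%N -> within 0 6 (cluster p lab n).
Proof. by move=> p6; rewrite /within all_map; apply/allP. Qed.

Lemma copy_within w : within 0 6 (copy w).
Proof. by rewrite /within !all_cat; apply/and3P; split; apply: cluster_within. Qed.

Lemma triple_sum_copy_move a w w' Y Z : off a (a + 6) Y -> off a (a + 6) Z ->
  triple_sum (shift a (copy w)) Y Z = triple_sum (shift a (copy w')) Y Z.
Proof.
move=> oY oZ; rewrite /copy !shift_cat !shift_cluster !triple_sum_catE.
have bd p : (p < 6)%N -> (a <= a + p < a + 6)%N by lia.
by congr (_ + (_ + _)); apply: (triple_sum_move (a := a) (b := (a + 6)%N)) => //; apply: bd.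
Qed.

(** The following three functions are the parts of [edge_sum] that depend on the
    word of a copy: triples inside the copy, and triples with two points in the
    copy and one in another copy to its right or to its left.  The word of that
    other copy does not matter, hence the default [w0]. *)
Definition w0 : word := (false, false, false).
Definition inner w := edge_sum (copy w).
Definition rightw w := triple_sum (copy w) (copy w) (shift 6 (copy w0)).
Definition leftw w := triple_sum (shift 6 (copy w)) (shift 6 (copy w)) (copy w0).

Lemma shift0 s : shift 0 s = s.
Proof. by rewrite /shift -[RHS]map_id; apply: eq_map => -[]. Qed.

Lemma triple_sum_inner a w : edge_sum (shift a (copy w)) = inner w.
Proof.
rewrite /inner /edge_sum -[copy w in RHS]shift0.
by apply: triple_sum_shift; rewrite ?copy_within // /sep !eqxx.
Qed.

Lemma triple_sum_right a b w w' : (a + 6 <= b)%N ->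
  triple_sum (shift a (copy w)) (shift a (copy w)) (shift b (copy w')) = rightw w.
Proof.
move=> ab; rewrite /rightw triple_sum23 triple_sum12 (triple_sum_copy_move w' w0); first last.
- by apply: within_off (shift_within a (copy_within w)); rewrite ab.
- by apply: within_off (shift_within a (copy_within w)); rewrite ab.
rewrite triple_sum12 triple_sum23 -[in RHS](shift0 (copy w)).
by apply: triple_sum_shift; rewrite ?copy_within // /sep; lia.
Qed.

Lemma triple_sum_left a b w w' : (b + 6 <= a)%N ->
  triple_sum (shift a (copy w)) (shift a (copy w)) (shift b (copy w')) = leftw w.
Proof.
move=> ab; rewrite /leftw triple_sum23 triple_sum12 (triple_sum_copy_move w' w0); first last.
- by apply: within_off (shift_within a (copy_within w)); rewrite ab orbT.
- by apply: within_off (shift_within a (copy_within w)); rewrite ab orbT.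
rewrite triple_sum12 triple_sum23 -[in RHS](shift0 (copy w0)).
by apply: triple_sum_shift; rewrite ?copy_within // /sep; lia.
Qed.

Definition pairs a Z w := triple_sum (shift a (copy w)) (shift a (copy w)) Z.

(** Triples with one point in the copy are not affected by its word, since the
    clusters move inside an interval that the other points avoid. *)
Lemma copy_flip a w w' Z : off a (a + 6) Z ->
  edge_sum (shift a (copy w) ++ Z) - (inner w + 3 * pairs a Z w)
  = edge_sum (shift a (copy w') ++ Z) - (inner w' + 3 * pairs a Z w').
Proof.
move=> oZ; rewrite !edge_sum_cat !triple_sum_inner (triple_sum_copy_move w w' oZ oZ) /pairs.
ring.
Qed.

(** Consecutive copies, and the total of the contributions that depend on their
    words: [r] stands for the pairs inside a copy with the points outside the
    list; each copy passed on the left adds [leftw] to it. *)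
Fixpoint conf a (ws : seq word) :=
  if ws is w :: ws' then shift a (copy w) ++ conf (a + 6) ws' else [::].

Fixpoint weight (r : word -> int) (ws : seq word) : int :=
  if ws is w :: ws' then
    inner w + 3 * (r w + (size ws')%:R * rightw w) + weight (fun w => r w + leftw w) ws'
  else 0.

Lemma eq_weight r r' ws : r =1 r' -> weight r ws = weight r' ws.
Proof.
elim: ws r r' => //= w ws IHws r r' rr; rewrite rr; congr (_ + _).
by apply: IHws => w'; rewrite rr.
Qed.

Lemma conf_within a ws : within a (a + 6 * size ws) (conf a ws).
Proof.
elim: ws a => //= w ws IHws a; rewrite /within all_cat; apply/andP; split.
  by apply: sub_all (shift_within a (copy_within w)) => x; lia.
by apply: sub_all (IHws (a + 6)%N) => x; lia.
Qed.

Lemma pairs_conf a b w ws : (a + 6 <= b)%N ->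
  pairs a (conf b ws) w = (size ws)%:R * rightw w.
Proof.
rewrite /pairs; elim: ws b => [|w' ws IHws] b ab /=.
  by rewrite mul0r triple_sum23 triple_sum12 /triple_sum big_nil.
rewrite triple_sum_cat3 triple_sum_right // IHws; last by lia.
by rewrite -[in RHS]natr1 mulrDl mul1r addrC.
Qed.

(** The words are changed one at a time from left to right; a copy that has
    received its new word joins the outside points [Z]. *)
Lemma conf_weight a ws ws' Z : size ws = size ws' -> off a (a + 6 * size ws) Z ->
  edge_sum (conf a ws ++ Z) - weight (pairs a Z) ws
  = edge_sum (conf a ws' ++ Z) - weight (pairs a Z) ws'.
Proof.
elim: ws ws' a Z => [|w ws IHws] [|w' ws'] //= a Z [sz] oZ.
rewrite -!catA.
have oZ6 : off a (a + 6) Z by apply: off_sub oZ; lia.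
have oC u : size u = size ws -> off a (a + 6) (conf (a + 6) u ++ Z).
  move=> su'; rewrite /off all_cat [X in _ && X]oZ6 andbT.
  by apply: within_off (conf_within _ _); rewrite leqnn orbT.
have := copy_flip w w' (oC _ erefl).
have pE u v : size u = size ws ->
    pairs a (conf (a + 6) u ++ Z) v = (size ws)%:R * rightw v + pairs a Z v.
  by move=> szu; rewrite {1}/pairs triple_sum_cat3 -!/(pairs _ _ _) pairs_conf // szu.
rewrite !pE // => h1.
have mv u : edge_sum (shift a (copy w') ++ conf (a + 6) u ++ Z) =
            edge_sum (conf (a + 6) u ++ (shift a (copy w') ++ Z)).
  by apply: edge_sum_perm; rewrite catA [X in _ _ X]catA perm_cat2r perm_catC.
rewrite mv in h1; rewrite mv.
have oZ' : off (a + 6) (a + 6 + 6 * size ws) (shift a (copy w') ++ Z).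
  rewrite /off all_cat; apply/andP; split.
    by apply: within_off (shift_within a (copy_within w')); rewrite leqnn.
  by apply: off_sub oZ; lia.
have h2 := IHws ws' _ _ sz oZ'.
have vE u : size u = size ws -> weight (pairs (a + 6) (shift a (copy w') ++ Z)) u =
            weight (fun w => pairs a Z w + leftw w) u.
  case: u => [//|w1 u] szu; apply: eq_weight => v; rewrite {1}/pairs triple_sum_cat3 triple_sum_left // addrC; congr (_ + _).
  by apply: (triple_sum_shift2 (copy_within v) (copy_within v) oZ); rewrite -?szu /=; lia.
rewrite !vE // in h2; rewrite -sz.
move: h1 h2; set X := edge_sum _; set Y := edge_sum _; set W := edge_sum _; set v1 := weight _ _; set v2 := weight _ _.
by clearbody X Y W v1 v2; lra.
Qed.

(** The four words of one parity, followed by the same words in reverse.  In a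
    palindrome the numbers of copies to the left and to the right of the two
    occurrences of a word add up to the same value for all words, so that
    [leftw] and [rightw] enter with constant coefficients. *)
Definition words b : seq word :=
  let e := [:: (b, b, b); (b, ~~ b, ~~ b); (~~ b, b, ~~ b); (~~ b, ~~ b, b)] in e ++ rev e.

Definition alt_sum (phi : word -> int) : int :=
  phi (false, false, false) + phi (false, true, true)
  + phi (true, false, true) + phi (true, true, false)
  - phi (true, true, true) - phi (true, false, false)
  - phi (false, true, false) - phi (false, false, true).

(** Every term sees at most two of the three bits. *)
Lemma alt_sum_pairs a Z : alt_sum (pairs a Z) = 0.
Proof. rewrite /alt_sum /pairs /copy !shift_cat !shift_cluster !triple_sum_catE /=; ring. Qed.

Lemma alt_sum_rightw : alt_sum rightw = 0.
Proof. by rewrite -(alt_sum_pairs 0 (shift 6 (copy w0))) /alt_sum /pairs !shift0. Qed.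

Lemma alt_sum_leftw : alt_sum leftw = 0.
Proof. exact: alt_sum_pairs. Qed.

Lemma weight_words r : alt_sum r = 0 ->
  weight r (words false) - weight r (words true) = 2 * alt_sum inner.
Proof.
have := alt_sum_leftw; have := alt_sum_rightw; rewrite /words /= /alt_sum.
set i0 := inner _; set i1 := inner _; set i2 := inner _; set i3 := inner _.
set i4 := inner _; set i5 := inner _; set i6 := inner _; set i7 := inner _.
move: i0 i1 i2 i3 i4 i5 i6 i7 => i0 i1 i2 i3 i4 i5 i6 i7.
set r0 := rightw _; set r1 := rightw _; set r2 := rightw _; set r3 := rightw _.
set r4 := rightw _; set r5 := rightw _; set r6 := rightw _; set r7 := rightw _.
move: r0 r1 r2 r3 r4 r5 r6 r7 => r0 r1 r2 r3 r4 r5 r6 r7.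
set l0 := leftw _; set l1 := leftw _; set l2 := leftw _; set l3 := leftw _.
set l4 := leftw _; set l5 := leftw _; set l6 := leftw _; set l7 := leftw _.
move: l0 l1 l2 l3 l4 l5 l6 l7 => l0 l1 l2 l3 l4 l5 l6 l7.
lra.
Qed.

Variables (M : nat) (e : nat -> nat -> nat -> bool).
Hypothesis hom : forall i j k n1 n2 n3, (i < 6)%N -> (j < 6)%N -> (k < 6)%N ->
  (n1 < M)%N -> (n2 < M)%N -> (n3 < M)%N ->
  F (i, labU n1) (j, labX n2) (k, labY n3) = e i j k.

Definition corner (w : word) : int := (e (pu w.1.1) (px w.1.2) (py w.2))%:R.

Lemma triple_sum_hom i j k : (su <= M)%N -> (sx <= M)%N -> (sy <= M)%N ->
  (i < 6)%N -> (j < 6)%N -> (k < 6)%N ->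
  triple_sum (cluster i labU su) (cluster j labX sx) (cluster k labY sy)
  = (su * sx * sy)%:R * (e i j k)%:R.
Proof.
move=> uM xM yM i6 j6 k6; rewrite /triple_sum !big_map.
have const (n : nat) (c : int) : \sum_(x <- iota 0 n) c = n%:R * c.
  by rewrite big_const_seq count_predT size_iota iter_addr_0 mulr_natl.
rewrite !natrM -!mulrA -const; apply: eq_big_seq => n1; rewrite mem_iota /= => n1u.
rewrite !big_map -const; apply: eq_big_seq => n2; rewrite mem_iota /= => n2u.
rewrite !big_map -const; apply: eq_big_seq => n3; rewrite mem_iota /= => n3u.
by rewrite hom //; lia.
Qed.

(** Only triples with one point in each cluster see all three bits; the factor 6
    counts their orderings. *)
Lemma alt_sum_inner : (su <= M)%N -> (sx <= M)%N -> (sy <= M)%N ->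
  alt_sum inner = 6 * (su * sx * sy)%:R * alt_sum corner.
Proof.
move=> uM xM yM; rewrite /alt_sum /corner /=.
pose U b := cluster (pu b) labU su; pose X b := cluster (px b) labX sx.
pose Y b := cluster (py b) labY sy.
pose tU b := triple_sum (U b) (U b) (U b); pose tX b := triple_sum (X b) (X b) (X b).
pose tY b := triple_sum (Y b) (Y b) (Y b).
pose ux b c := 3 * triple_sum (U b) (U b) (X c) + 3 * triple_sum (U b) (X c) (X c).
pose uy b c := 3 * triple_sum (U b) (U b) (Y c) + 3 * triple_sum (U b) (Y c) (Y c).
pose xy b c := 3 * triple_sum (X b) (X b) (Y c) + 3 * triple_sum (X b) (Y c) (Y c).
have h b c d : inner (b, c, d) = tU b + tX c + tY d + ux b c + uy b d + xy c d
    + 6 * ((su * sx * sy)%:R * (e (pu b) (px c) (py d))%:R).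
  rewrite -triple_sum_hom // /inner /copy /= -!/(U _) -!/(X _) -!/(Y _).
  rewrite !edge_sum_cat !triple_sum_catE /tU /tX /tY /ux /uy /xy /edge_sum.
  rewrite (triple_sum23 (U b) (Y d) (X c)).
  ring.
rewrite !h; ring.
Qed.

(** The effect of switching does not depend on [Z]: switches add up. *)
Lemma words_flip a Z : (su <= M)%N -> (sx <= M)%N -> (sy <= M)%N -> off a (a + 48) Z ->
  edge_sum (conf a (words false) ++ Z) - edge_sum (conf a (words true) ++ Z)
  = 12 * (su * sx * sy)%:R * alt_sum corner.
Proof.
move=> uM xM yM oZ.
have := @conf_weight a (words false) (words true) Z erefl oZ.
have := weight_words (alt_sum_pairs a Z); rewrite alt_sum_inner //.
set X := edge_sum _; set Y := edge_sum _; set v1 := weight _ _; set v2 := weight _ _.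
set c := alt_sum _; set s := (su * sx * sy)%:R; clearbody X Y v1 v2 c s; lra.
Qed.

End Sizes.

(** Three nearly equal powers of 2 with product [2 ^ d]: the digit of weight
    [2 ^ d] costs only about [2 ^ (d / 3)] vertices. *)
Definition cluster_size r d := (2 ^ ((d + r) %/ 3))%N.

Lemma cluster_size_prod d : (cluster_size 0 d * cluster_size 1 d * cluster_size 2 d = 2 ^ d)%N.
Proof. by rewrite /cluster_size -!expnD; congr (_ ^ _)%N; lia. Qed.

Definition digit d b := conf (cluster_size 0 d) (cluster_size 1 d) (cluster_size 2 d) (48 * d) (words b).

Lemma digit_within d b : within (48 * d) (48 * d + 48) (digit d b).
Proof. exact: (conf_within _ _ _ _ (words b)). Qed.

(** The state of the gadgets [d], ..., [d + n - 1] is given by the binary digits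
    of [j]; each gadget occupies 8 copies of 6 positions. *)
Fixpoint digits d n j :=
  if n is n'.+1 then digit d (odd j) ++ digits d.+1 n' j./2 else [::].

Lemma digitsS d n j : digits d n.+1 j = digit d (odd j) ++ digits d.+1 n j./2.
Proof. by []. Qed.

Lemma digits_within d n j : within (48 * d) (48 * (d + n)) (digits d n j).
Proof.
elim: n d j => // n IHn d j; rewrite digitsS /within all_cat; apply/andP; split.
  by apply: sub_all (conf_within _ _ _ _ _) => x /=; lia.
by apply: sub_all (IHn d.+1 _) => x /=; lia.
Qed.

Variables (M : nat) (e : nat -> nat -> nat -> bool).
Hypothesis hom : forall i j k n1 n2 n3, (i < 6)%N -> (j < 6)%N -> (k < 6)%N ->
  (n1 < M)%N -> (n2 < M)%N -> (n3 < M)%N ->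
  F (i, labU n1) (j, labX n2) (k, labY n3) = e i j k.

Lemma cluster_size_le r d q : (r <= 2)%N -> (d < 3 * q)%N -> (2 ^ q <= M)%N -> (cluster_size r d <= M)%N.
Proof.
move=> r2 dq; apply: leq_trans; rewrite leq_exp2l //; lia.
Qed.

Lemma digits_sum q d n j Z : (2 ^ q <= M)%N -> (d + n <= 3 * q)%N -> (j < 2 ^ n)%N ->
  off (48 * d) (48 * (d + n)) Z ->
  edge_sum (digits d n 0 ++ Z) - edge_sum (digits d n j ++ Z)
  = 12 * alt_sum (corner e) * (2 ^ d * j)%:R.
Proof.
move=> qM; elim: n d j Z => [|n IHn] d j Z dn jn oZ.
  by move: jn; rewrite expn0 ltnS leqn0 => /eqP ->; rewrite subrr muln0 mulr0.
rewrite !digitsS -(catA (digit d false)) -(catA (digit d (odd j))).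
have jn2 : (j./2 < 2 ^ n)%N by move: jn; rewrite expnS; lia.
have oC b : off (48 * d.+1) (48 * (d.+1 + n)) (digit d b ++ Z).
  rewrite /off all_cat; apply/andP; split.
    by apply: within_off (digit_within _ _); lia.
  by apply: off_sub oZ; lia.
have mv b s : edge_sum (digit d b ++ s ++ Z) = edge_sum (s ++ digit d b ++ Z).
  by apply: edge_sum_perm; rewrite perm_catCA.
have h1 : edge_sum (digit d false ++ digits d.+1 n 0 ++ Z) - edge_sum (digit d false ++ digits d.+1 n j./2 ++ Z)
    = 12 * alt_sum (corner e) * (2 ^ d.+1 * j./2)%:R.
  by rewrite !mv; apply: IHn => //; lia.
have h2 : edge_sum (digit d false ++ digits d.+1 n j./2 ++ Z) - edge_sum (digit d (odd j) ++ digits d.+1 n j./2 ++ Z)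
    = 12 * alt_sum (corner e) * (2 ^ d * odd j)%:R.
  case: (odd j); last by rewrite subrr muln0 mulr0.
  rewrite muln1 -cluster_size_prod mulrAC; rewrite /digit; apply: (words_flip hom).
  1-3: by apply: (@cluster_size_le _ _ q) => //; lia.
  rewrite /off all_cat; apply/andP; split.
    by apply: within_off (digits_within _ _ _); lia.
  by apply: off_sub oZ; lia.
rewrite -[j in RHS]odd_double_half mulnDr natrD mulrDr -h2.
rewrite -muln2 [(j./2 * 2)%N]mulnC mulnA -expnSr -h1.
ring.
Qed.

Definition labels : seq L :=
  [seq labU i | i <- iota 0 M] ++ [seq labX i | i <- iota 0 M] ++ [seq labY i | i <- iota 0 M].

Lemma size_conf su sx sy a ws : size (conf su sx sy a ws) = (size ws * (su + sx + sy))%N.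
Proof.
elim: ws a => //= w ws IHws a.
by rewrite size_cat IHws size_map !size_cat !size_map !size_iota; lia.
Qed.

Lemma size_digitsS d n j : size (digits d n.+1 j) =
  (8 * (cluster_size 0 d + cluster_size 1 d + cluster_size 2 d) + size (digits d.+1 n j./2))%N.
Proof. by rewrite digitsS [LHS]size_cat [size (digit _ _)]size_conf. Qed.

(** The digits [3 i], [3 i + 1], [3 i + 2] use [8 * 12 * 2 ^ i] vertices. *)
Lemma size_digits e' k j :
  (size (digits (3 * e') (3 * k) j) + 96 * 2 ^ e' = 96 * 2 ^ (e' + k))%N.
Proof.
elim: k e' j => [|k IHk] e' j; first by rewrite addn0.
rewrite (_ : 3 * k.+1 = (3 * k).+3)%N; last by lia.
rewrite !size_digitsS -addSnnS -(IHk _ (j./2./2./2)).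
rewrite (_ : (3 * e').+3 = 3 * e'.+1)%N; last by lia.
have p r d u : ((d + r) %/ 3 = u)%N -> cluster_size r d = (2 ^ u)%N by rewrite /cluster_size => ->.
rewrite (p 0 (3 * e')%N e'); last by lia.
rewrite (p 1 (3 * e')%N e'); last by lia.
rewrite (p 2 (3 * e')%N e'); last by lia.
rewrite (p 0 (3 * e').+1%N e'); last by lia.
rewrite (p 1 (3 * e').+1%N e'); last by lia.
rewrite (p 2 (3 * e').+1%N e'.+1); last by lia.
rewrite (p 0 (3 * e').+2%N e'); last by lia.
rewrite (p 1 (3 * e').+2%N e'.+1); last by lia.
rewrite (p 2 (3 * e').+2%N e'.+1); last by lia.
rewrite expnS; lia.
Qed.

Lemma copy_labels su sx sy w : (su <= M)%N -> (sx <= M)%N -> (sy <= M)%N ->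
  subseq [seq x.2 | x <- copy su sx sy w] labels.
Proof.
move=> uM xM yM; rewrite /copy !map_cat -!map_comp /labels.
have sub (lab : nat -> L) n : (n <= M)%N ->
    subseq [seq lab i | i <- iota 0 n] [seq lab i | i <- iota 0 M].
  by move=> nM; rewrite -(subnKC nM) iotaD map_cat prefix_subseq.
by rewrite !cat_subseq // sub.
Qed.

Lemma conf_labels su sx sy a ws : (su <= M)%N -> (sx <= M)%N -> (sy <= M)%N ->
  all (fun x => x.2 \in labels) (conf su sx sy a ws).
Proof.
move=> uM xM yM; elim: ws a => //= w ws IHws a; rewrite all_cat IHws andbT all_map.
apply/allP => x xw /=; apply: (mem_subseq (copy_labels w uM xM yM)); exact: map_f.
Qed.

Lemma digits_labels q d n j : (2 ^ q <= M)%N -> (d + n <= 3 * q)%N ->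
  all (fun x => x.2 \in labels) (digits d n j).
Proof.
move=> qM; elim: n d j => // n IHn d j dn; rewrite digitsS all_cat IHn ?andbT; last by lia.
by apply: conf_labels; apply: (@cluster_size_le _ _ q) => //; lia.
Qed.

Lemma cat_uniq_within a b s Z : uniq s -> uniq Z -> within a b s -> off a b Z ->
  uniq (s ++ Z).
Proof.
move=> us uZ /allP ws /allP oZ; rewrite cat_uniq us uZ andbT; apply/hasPn => x xZ.
by apply/negP => xs; have := ws x xs; have := oZ x xZ; lia.
Qed.

Hypothesis labels_uniq : uniq labels.

Lemma conf_uniq su sx sy a ws : (su <= M)%N -> (sx <= M)%N -> (sy <= M)%N ->
  uniq (conf su sx sy a ws).
Proof.
move=> uM xM yM; elim: ws a => // w ws IHws a /=.
apply: (@cat_uniq_within a (a + 6)) => //.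
- rewrite map_inj_uniq; last by move=> [x l] [y l'] [] /addnI -> ->.
  exact/(@map_uniq _ _ snd)/(subseq_uniq (copy_labels w uM xM yM)).
- exact: shift_within (copy_within _ _ _ _).
- by apply: within_off (conf_within _ _ _ _ _); rewrite leqnn orbT.
Qed.

Lemma digits_uniq q d n j : (2 ^ q <= M)%N -> (d + n <= 3 * q)%N -> uniq (digits d n j).
Proof.
move=> qM; elim: n d j => // n IHn d j dn; rewrite digitsS.
apply: (@cat_uniq_within (48 * d) (48 * d + 48)).
- by apply: conf_uniq; apply: (@cluster_size_le _ _ q) => //; lia.
- by apply: IHn; lia.
- exact: digit_within.
- by apply: within_off (digits_within _ _ _); lia.
Qed.

End Gadget.

(** * A nonzero alternating sum *)

(** For each pair [p], [r] the hypothesis says that [s q p - s q r] is the same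
    number [s p r - s r p] for all [q].  If it were nonzero, two further letters
    would contradict each other; so [s] is symmetric and constant on rows. *)
Lemma balanced_four (I : eqType) (s : I -> I -> bool) (a b c d : I) :
  uniq [:: a; b; c; d] ->
  (forall p q r, uniq [:: p; q; r] -> s q p + s r p = s p r + s q r) ->
  s a b = s b a /\ s a b = s a c.
Proof.
rewrite /= !inE !negb_or => /and4P[/and3P[ab ac ad] /andP[bc bd] cd _] H.
have E p q r : p != q -> p != r -> q != r -> s q p + s r p = s p r + s q r.
  by move=> pq pr qr; apply: H; rewrite /= !inE negb_or pq pr qr.
move: ab ac ad bc bd cd => ab ac ad bc bd cd.
have [ba ca da] : [/\ b != a, c != a & d != a] by split; rewrite eq_sym.
have [cb db dc] : [/\ c != b, d != b & d != c] by split; rewrite eq_sym.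
move: (E a b c ab ac bc) (E a b d ab ad bd) (E a c b ac ab cb) (E a c d ac ad cd)
 (E a d b ad ab db) (E a d c ad ac dc) (E b a c ba bc ac) (E b a d ba bd ad)
 (E b c d bc bd cd) (E b d c bd bc dc) (E c a d ca cd ad) (E c b d cb cd bd).
by case: (s a b); case: (s b a); case: (s c a); case: (s c b) => //;
  case: (s d a); case: (s d b) => //; case: (s a c); case: (s b c) => //;
  case: (s a d); case: (s b d) => //; case: (s c d); case: (s d c).
Qed.

Lemma fourth (p q r : nat) : exists2 d, d < 4 & uniq [:: p; q; r] -> uniq [:: p; q; r; d].
Proof.
have [|d] := boolP (has (fun d => d \notin [:: p; q; r]) (iota 0 4)).
  case/hasP => d; rewrite mem_iota /= => d4 nd; exists d => // u.
  by move: nd u; rewrite /= !inE; lia.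
by exfalso; move: d; rewrite /= !inE !negb_or; lia.
Qed.

Lemma balanced_const n (s : nat -> nat -> bool) : 4 <= n ->
  (forall p q r, p < n -> q < n -> r < n -> uniq [:: p; q; r] ->
     s q p + s r p = s p r + s q r) ->
  forall p q, p < n -> q < n -> p != q -> s p q = s 0 1.
Proof.
move=> n4 H.
have four a b c d : a < n -> b < n -> c < n -> d < n -> uniq [:: a; b; c; d] ->
    s a b = s b a /\ s a b = s a c.
  move=> an bn cn dn abcd.
  pose I := 'I_n; pose a' : I := Ordinal an; pose b' : I := Ordinal bn.
  pose c' : I := Ordinal cn; pose d' : I := Ordinal dn.
  apply: (@balanced_four I (fun x y => s x y) a' b' c' d').
    by rewrite -(map_inj_uniq val_inj).
  by move=> p q r pqr; apply: H.
have three a b c : a < n -> b < n -> c < n -> uniq [:: a; b; c] ->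
    s a b = s b a /\ s a b = s a c.
  move=> an bn cn abc; have [d d4 /(_ abc) abcd] := fourth a b c.
  by apply: (@four a b c d) => //; apply: leq_trans n4.
have row a b c : a < n -> b < n -> c < n -> a != b -> a != c -> s a b = s a c.
  move=> an bn cn ab ac; case: (eqVneq b c) => [-> //|bc].
  by apply: (proj2 (three a b c _ _ _ _)); rewrite //= !inE negb_or ab ac bc.
have sym a b : a < n -> b < n -> a != b -> s a b = s b a.
  move=> an bn ab; have [d d4 nd] := fourth a b (a + b + 4).
  have /nd : uniq [:: a; b; a + b + 4] by rewrite /= !inE; lia.
  rewrite /= !inE => u; apply: (proj1 (three a b d _ _ _ _)) => //.
    exact: leq_trans n4.
  by rewrite /= !inE; lia.
have n1 : 1 < n by apply: leq_trans n4.
move=> p q pn qn pq; case: (posnP p) => [p0|p0].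
  by rewrite p0 in pq *; apply: row => //; apply: ltnW.
have n0 : 0 < n by exact: ltnW.
by rewrite (row p q 0) // -?lt0n // (sym p 0) // -?lt0n //; apply: row => //; rewrite eq_sym -lt0n.
Qed.

(** The letter [l] consists of the [M] labels [l * M], ..., [l * M + M - 1] of one
    part.  Letters 0 to 4 lie in the complete pattern and 5 to 9 in the empty
    one; in each pattern two of the parts carry two letters, which serve to
    compare letters of the same part. *)
Definition letter M (l a : nat) : bool * 'I_3 * nat :=
  (nth (true, 0%R) [:: (true, 0%R); (true, 0%R); (true, 1%R); (true, 1%R); (true, 2%:R%R);
     (false, 0%R); (false, 0%R); (false, 1%R); (false, 1%R); (false, 2%:R%R)] l,
   l * M + a).

Section NonzeroAltSum.

Variables (M : nat).
Local Notation L := (bool * 'I_3 * nat)%type.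
Variable F : nat * L -> nat * L -> nat * L -> bool.
Hypothesis M1 : 1 < M.
Let M0 : 0 < M. Proof. exact: ltnW. Qed.
Hypothesis F12 : forall x y z, F x y z = F y x z.
Hypothesis F23 : forall x y z, F x y z = F x z y.
Hypothesis Find : order_invariant F.
Hypothesis Flast : forall i j k l1 l2 l3 l4, i < k -> j < k ->
  F (i, l1) (j, l2) (k, l3) = F (i, l1) (j, l2) (k, l4).
Hypothesis Fhom : forall i j k p1 p2 p3 x1 x2 x3 y1 y2 y3,
  x1 < x2 -> x2 < x3 -> x3 < 10 * M -> y1 < y2 -> y2 < y3 -> y3 < 10 * M ->
  F (i, (p1, x1)) (j, (p2, x2)) (k, (p3, x3)) = F (i, (p1, y1)) (j, (p2, y2)) (k, (p3, y3)).
Hypothesis Fblock : forall b x y z,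
  F (0, ((b, 0%R), x)) (0, ((b, 1%R), y)) (0, ((b, 2%:R%R), z)) = b.

Local Notation lab l := (letter M l 0).
Definition at_letters l1 l2 l3 i j k := F (i, lab l1) (j, lab l2) (k, lab l3).

Lemma letter_lt l l' a b : l < l' -> a < M -> l * M + a < l' * M + b.
Proof.
move=> ll aM; apply: (@leq_trans (l.+1 * M)); first by rewrite mulSn addnC ltn_add2r.
by apply: leq_trans (leq_addr _ _); rewrite leq_mul2r ll orbT.
Qed.

Lemma letter_hom l1 l2 l3 i j k a b c : l1 < 10 -> l2 < 10 -> l3 < 10 ->
  uniq [:: l1; l2; l3] -> a < M -> b < M -> c < M ->
  F (i, letter M l1 a) (j, letter M l2 b) (k, letter M l3 c) = at_letters l1 l2 l3 i j k.
Proof.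
have H m1 m2 m3 i' j' k' a' b' c' : m1 < m2 -> m2 < m3 -> m3 < 10 -> a' < M -> b' < M -> c' < M ->
    F (i', letter M m1 a') (j', letter M m2 b') (k', letter M m3 c')
    = F (i', lab m1) (j', lab m2) (k', lab m3).
  move=> m12 m23 m3n aM bM cM; apply: Fhom; try exact: letter_lt.
    by rewrite -[X in _ < X]addn0; exact: letter_lt.
  by rewrite -[X in _ < X]addn0; exact: letter_lt.
rewrite /at_letters => l1n l2n l3n u aM bM cM.
have [l12|l12|l12] := ltngtP l1 l2; last by move: u; rewrite /= !inE; lia.
- have [l23|l23|l23] := ltngtP l2 l3; last by move: u; rewrite /= !inE; lia.
    exact: H.
  have [l13|l13|l13] := ltngtP l1 l3; last by move: u; rewrite /= !inE; lia.
    by rewrite F23 [RHS]F23; apply: H.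
  by rewrite F23 F12 [RHS]F23 [RHS]F12; apply: H.
have [l13|l13|l13] := ltngtP l1 l3; last by move: u; rewrite /= !inE; lia.
  by rewrite F12 [RHS]F12; apply: H.
have [l23|l23|l23] := ltngtP l2 l3; last by move: u; rewrite /= !inE; lia.
  by rewrite F12 F23 [RHS]F12 [RHS]F23; apply: H.
by rewrite F12 F23 F12 [RHS]F12 [RHS]F23 [RHS]F12; apply: H.
Qed.

(** The two positions of the [r]-th cluster: [r] and [r + 3], or else [2] and
    [r + 3].  In the first family no two clusters share a block; in the second
    they all start in the block 2 and leave it to the right. *)
Definition place (far : bool) (r : nat) (b : bool) : nat :=
  if far then r + 3 * b else if b then r + 3 else 2.

Arguments place : simpl never.

Lemma place_lt far r b : r < 3 -> place far r b < 6.
Proof. by rewrite /place; case: far; case: b; lia. Qed.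

(** If all alternating sums of the two families vanish, the first family gives
    [far_eq], hence a common value [s 0 1] for triples in three different
    blocks; the second gives [tri].  Two letters of one part then show that
    [t] takes the same value on letters of different parts ([tS]), and [tri] makes the complete and the empty
    pattern equal. *)
Lemma nonzero_alt_sum : exists far l1 l2 l3,
  [/\ l1 < 10, l2 < 10, l3 < 10, uniq [:: l1; l2; l3] &
   alt_sum (corner (place far 0) (place far 1) (place far 2) (at_letters l1 l2 l3)) != 0%R].
Proof.
pose c far l1 l2 l3 :=
  alt_sum (corner (place far 0) (place far 1) (place far 2) (at_letters l1 l2 l3)).
case: (boolP [exists far, exists l1 : 'I_10, exists l2 : 'I_10, exists l3 : 'I_10,
  uniq [:: val l1; val l2; val l3] && (c far l1 l2 l3 != 0%R)]).
  case/existsP => far /existsP[l1 /existsP[l2 /existsP[l3 /andP[u nz]]]].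
  by exists far, l1, l2, l3.
move=> none; exfalso.
have c0 far l1 l2 l3 : l1 < 10 -> l2 < 10 -> l3 < 10 -> uniq [:: l1; l2; l3] ->
    c far l1 l2 l3 = 0%R.
  move=> h1 h2 h3 u; apply/eqP; apply: contraNT none => nz.
  apply/existsP; exists far; apply/existsP; exists (Ordinal h1).
  apply/existsP; exists (Ordinal h2); apply/existsP; exists (Ordinal h3).
  by apply/andP.
(* By [Flast] the letter of the last point is irrelevant in [s] and [t]. *)
pose s p q := F (0, lab p) (1, lab q) (2, lab 0).
pose t p q := F (0, lab p) (0, lab q) (1, lab 0).
pose h p q r := F (0, lab p) (0, lab q) (0, lab r).
have sE i j k p q r : i < j -> j < k -> F (i, lab p) (j, lab q) (k, lab r) = s p q.
  move=> ij jk; rewrite (@Flast _ _ _ _ _ _ (lab 0)) //; last exact: ltn_trans jk.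
  by apply: Find; lia.
have tE i k p q r : i < k -> F (i, lab p) (i, lab q) (k, lab r) = t p q.
  move=> ik; rewrite (@Flast _ _ _ _ _ _ (lab 0)) //.
  by apply: Find; lia.
have hE i p q r : F (i, lab p) (i, lab q) (i, lab r) = h p q r.
  by apply: Find; lia.
have far_eq p q r : p < 10 -> q < 10 -> r < 10 -> uniq [:: p; q; r] ->
    s q p + s r p = s p r + s q r.
  move=> pn qn rn u; have := c0 true p q r pn qn rn u.
  rewrite /c /alt_sum /corner /at_letters /=.
  have -> : F (place true 0 false, lab p) (place true 1 false, lab q) (place true 2 false, lab r) = s p q by rewrite //; exact: sE.
  have -> : F (place true 0 false, lab p) (place true 1 true, lab q) (place true 2 true, lab r) = s p q by rewrite //; exact: sE.
  have -> : F (place true 0 true, lab p) (place true 1 false, lab q) (place true 2 true, lab r) = s q p by rewrite F12 //; exact: sE.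
  have -> : F (place true 0 true, lab p) (place true 1 true, lab q) (place true 2 false, lab r) = s r p by rewrite F23 F12 //; exact: sE.
  have -> : F (place true 0 true, lab p) (place true 1 true, lab q) (place true 2 true, lab r) = s p q by rewrite //; exact: sE.
  have -> : F (place true 0 true, lab p) (place true 1 false, lab q) (place true 2 false, lab r) = s q r by rewrite F12 F23 //; exact: sE.
  have -> : F (place true 0 false, lab p) (place true 1 true, lab q) (place true 2 false, lab r) = s p r by rewrite F23 //; exact: sE.
  have -> : F (place true 0 false, lab p) (place true 1 false, lab q) (place true 2 true, lab r) = s p q by rewrite //; exact: sE.
  by rewrite !natz; clear; lia.
have near_eq p q r : p < 10 -> q < 10 -> r < 10 -> uniq [:: p; q; r] ->
    h p q r + s q p + s r p = t p q + t p r + t q r.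
  move=> pn qn rn u; have := c0 false p q r pn qn rn u.
  rewrite /c /alt_sum /corner /at_letters /=.
  have -> : F (place false 0 false, lab p) (place false 1 false, lab q) (place false 2 false, lab r) = h p q r by rewrite //; exact: hE.
  have -> : F (place false 0 false, lab p) (place false 1 true, lab q) (place false 2 true, lab r) = s p q by rewrite //; exact: sE.
  have -> : F (place false 0 true, lab p) (place false 1 false, lab q) (place false 2 true, lab r) = s q p by rewrite F12 //; exact: sE.
  have -> : F (place false 0 true, lab p) (place false 1 true, lab q) (place false 2 false, lab r) = s r p by rewrite F23 F12 //; exact: sE.
  have -> : F (place false 0 true, lab p) (place false 1 true, lab q) (place false 2 true, lab r) = s p q by rewrite //; exact: sE.
  have -> : F (place false 0 true, lab p) (place false 1 false, lab q) (place false 2 false, lab r) = t q r by rewrite F12 F23 //; exact: tE.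
  have -> : F (place false 0 false, lab p) (place false 1 true, lab q) (place false 2 false, lab r) = t p r by rewrite F23 //; exact: tE.
  have -> : F (place false 0 false, lab p) (place false 1 false, lab q) (place false 2 true, lab r) = t p q by rewrite //; exact: tE.
  by rewrite !natz; clear; lia.
have sC p q : p < 10 -> q < 10 -> p != q -> s p q = s 0 1.
  by apply: (balanced_const (n := 10)).
have tri p q r : p < 10 -> q < 10 -> r < 10 -> uniq [:: p; q; r] ->
    h p q r + 2 * s 0 1 = t p q + t p r + t q r.
  move=> pn qn rn u; have := near_eq p q r pn qn rn u.
  by move: u; rewrite /= !inE !negb_or => /and3P[/andP[pq pr] _ _]; rewrite !sC // 1?eq_sym //; lia.
have tsame p p' q : p < q -> p' < q -> q < 10 -> (letter M p 0).1 = (letter M p' 0).1 ->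
    t p q = t p' q.
  move=> pq p'q qn eqp; rewrite /t !(@Flast 0 0 1 _ _ _ ((true, 0%R), 9 * M + 1)) //.
  rewrite [lab p]surjective_pairing [lab p']surjective_pairing eqp.
  have q9 : q * M + 0 < 9 * M + 1 by rewrite addn0 addn1 ltnS leq_mul2r -ltnS qn orbT.
  have M9 : 9 * M + 1 < 10 * M by rewrite (mulSn 9) addnC ltn_add2r.
  by apply: Fhom => //; apply: letter_lt.
have tS p p' q : p < p' -> p' < q -> q < 10 -> (letter M p 0).1 = (letter M p' 0).1 ->
    t p q = s 0 1.
  move=> pp' p'q qn eqp; have pq := ltn_trans pp' p'q.
  have p'n := ltn_trans p'q qn; have pn := ltn_trans pp' p'n.
  have u : uniq [:: p; p'; q] by rewrite /= !inE !ltn_eqF.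
  have := tri p p' q pn p'n qn u; rewrite -(tsame p p' q pq p'q qn eqp).
  by case: (h p p' q); case: (t p p'); case: (t p q); case: (s 0 1).
have h024 : h 0 2 4 = true by exact: Fblock.
have h579 : h 5 7 9 = false by exact: Fblock.
have := tri 0 2 4 isT isT isT isT; have := tri 5 7 9 isT isT isT isT.
rewrite h024 h579 (tS 0 1 2) // (tS 0 1 4) // (tS 2 3 4) //.
rewrite (tS 5 6 7) // (tS 5 6 9) // (tS 7 8 9) //.
by case: (s 0 1).
Qed.
End NonzeroAltSum.

(** * From gadgets to many sizes *)

Lemma sum_set_seq (V : finType) (s : seq V) (f : V -> nat) : uniq s ->
  \sum_(x in [set x in s]) f x = \sum_(x <- s) f x.
Proof. by move=> us; rewrite big_uniq //=; apply: eq_bigl => x; rewrite inE. Qed.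

Lemma num_edges_le (V : finType) (G : three_graph V) (S : {set V}) :
  num_edges G S <= 'C(#|S|, 3).
Proof.
rewrite -cards_draws; apply: subset_leq_card; apply/subsetP => e.
by rewrite !inE => /andP[/edges_card3 -> ->].
Qed.

Lemma letter_inj m l l' a b : a < m -> b < m -> letter m l a = letter m l' b ->
  l = l' /\ a = b.
Proof.
move=> am bm [_ eqx]; have [lt|gt|eql] := ltngtP l l'.
- by have := letter_lt b lt am; rewrite eqx ltnn.
- by have := letter_lt a gt bm; rewrite eqx ltnn.
- by split => //; move: eqx; rewrite eql => /addnI.
Qed.

Lemma labels_letter m l1 l2 l3 : uniq [:: l1; l2; l3] ->
  uniq (labels (letter m l1) (letter m l2) (letter m l3) m).
Proof.
rewrite /= !inE negb_or andbT => /andP[/andP[l12 l13] l23].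
have inj l : uniq [seq letter m l i | i <- iota 0 m].
  rewrite map_inj_in_uniq ?iota_uniq // => a b; rewrite !mem_iota /= => am bm.
  by case/(letter_inj am bm).
have dis l l' : l != l' -> ~~ has (mem [seq letter m l i | i <- iota 0 m])
    [seq letter m l' i | i <- iota 0 m].
  move=> ll; apply/hasPn => x /mapP[a + ->]; rewrite mem_iota => am.
  apply/negP => /mapP[b]; rewrite mem_iota => bm /(letter_inj am bm) [eql _].
  by rewrite eql eqxx in ll.
rewrite /labels !cat_uniq has_cat !inj negb_or !dis //.
Qed.

Lemma labels_bound m l1 l2 l3 x : l1 < 10 -> l2 < 10 -> l3 < 10 ->
  x \in labels (letter m l1) (letter m l2) (letter m l3) m -> x.2 < 10 * m.
Proof.
move=> h1 h2 h3; rewrite /labels !mem_cat => /or3P[] /mapP[a]; rewrite mem_iota => am ->;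
  by rewrite -[X in _ < X]addn0; apply: letter_lt.
Qed.

(** The gadgets with [3 * q] binary digits use [96 * 2 ^ q - 96] vertices; the
    remaining ones are static and lie to the right.  The sets for two states
    [j] have numbers of edges that differ by a fixed nonzero multiple of the
    difference of the states. *)
Lemma many_sizes m q : 3 <= m -> 2 ^ q <= m -> 96 * 2 ^ q <= m + 96 ->
  exists t A, forall (V : finType) (G : three_graph V) N,
  0 < N -> rich (edges G) t N -> A * N <= #|V| -> 2 ^ (3 * q) <= num_sizes G m.
Proof.
move=> m3 qm cost.
pose B := 48 * (3 * q) + m.
have B3 : 3 <= B by apply: leq_trans m3 _; exact: leq_addl.
have [t [A sys]] := uniform_system (10 * m) B3.
exists t, A => V G N N0 rch bigV.
have [w [w1 w2 w3 w4 w5]] := sys V (edges G) N N0 rch bigV.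
pose L := (bool * 'I_3 * nat)%type.
(* The positions are replaced by their ranks, so that order invariance holds by
   construction for all positions; [F_vert] compares [F] with the graph. *)
pose at_ (r : nat) (x : nat * L) := w r x.2.1 x.2.2.
pose F (x y z : nat * L) := edge (edges G) (at_ (rk x.1 y.1 z.1) x)
  (at_ (rk y.1 x.1 z.1) y) (at_ (rk z.1 x.1 y.1) z).
have F12 x y z : F x y z = F y x z by rewrite /F edge12 (rkC z.1).
have F23 x y z : F x y z = F x z y by rewrite /F edge23 (rkC x.1).
have Find : order_invariant F.
  move=> i j k i' j' k' a b c h1 h2 h3 h4 h5 h6; rewrite /F /=.
  by rewrite (eq_rk h2 h4) // (eq_rk h1 h6) // (eq_rk h3 h5).
have Flast i j k l1 l2 l3 l4 : i < k -> j < k ->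
    F (i, l1) (j, l2) (k, l3) = F (i, l1) (j, l2) (k, l4).
  move=> ik jk; rewrite /F /=; apply: w3; last exact: leq_trans (rk_lt3 _ _ _) B3.
    exact: rk_lt.
  by rewrite (rkC k); apply: rk_lt.
have Fhom i j k p1 p2 p3 x1 x2 x3 y1 y2 y3 :
    x1 < x2 -> x2 < x3 -> x3 < 10 * m -> y1 < y2 -> y2 < y3 -> y3 < 10 * m ->
    F (i, (p1, x1)) (j, (p2, x2)) (k, (p3, x3)) = F (i, (p1, y1)) (j, (p2, y2)) (k, (p3, y3)).
  by move=> *; apply: w4; rewrite ?rk_lt3.
have Fblock b x y z :
    F (0, ((b, 0%R), x)) (0, ((b, 1%R), y)) (0, ((b, 2%:R%R), z)) = b by exact: w5.
have m1 : 1 < m by exact: ltnW.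
have [far [l1 [l2 [l3 [h1 h2 h3 u nz]]]]] := nonzero_alt_sum m1 F12 F23 Find Flast Fhom Fblock.
have hom i j k a b c : i < 6 -> j < 6 -> k < 6 -> a < m -> b < m -> c < m ->
    F (i, letter m l1 a) (j, letter m l2 b) (k, letter m l3 c) = at_letters m F l1 l2 l3 i j k.
  by move=> _ _ _; apply: letter_hom.
have p6 r b : r < 3 -> place far r b < 6 by exact: place_lt.
pose D j := digits (place far 0) (place far 1) (place far 2)
  (letter m l1) (letter m l2) (letter m l3) 0 (3 * q) j.
have sizeD j : size (D j) + 96 = 96 * 2 ^ q.
  by have := size_digits (place far 0) (place far 1) (place far 2)
    (letter m l1) (letter m l2) (letter m l3) 0 q j; rewrite muln0 expn0 muln1 add0n.
pose P := [seq (48 * (3 * q) + h, letter m l1 0) | h <- iota 0 (m + 96 - 96 * 2 ^ q)].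
pose pts j := D j ++ P.
have size_pts j : size (pts j) = m.
  by rewrite size_cat size_map size_iota; have := sizeD j; lia.
have offP : off 0 (48 * (3 * q)) P.
  by rewrite /off all_map; apply/allP => h _ /=; rewrite leq_addr.
have withinD j : within 0 (48 * (3 * q)) (D j).
  by apply: (@digits_within L (place far 0) (place far 1) (place far 2)
    (letter m l1) (letter m l2) (letter m l3) _ _ _ 0 (3 * q) j) => b; apply: p6.
have uniq_pts j : uniq (pts j).
  apply: cat_uniq_within (withinD j) offP.
    by apply: (digits_uniq _ _ _ (labels_letter m u) j qm) => // b; apply: p6.
  by rewrite map_inj_uniq ?iota_uniq // => a b [] /addnI.
have valid j x : x \in pts j -> x.1 < B /\ x.2.2 < 10 * m.
  rewrite mem_cat => /orP[xD|/mapP[h]].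
    split; last first.
      apply: (labels_bound h1 h2 h3 (m := m)); move: x xD; apply/allP.
      exact: digits_labels qm _.
    have /allP /(_ x xD) /andP[_ xB] := withinD j.
    by apply: leq_trans xB _; exact: leq_addr.
  rewrite mem_iota /= => hm ->; split.
    have q0 : 0 < 2 ^ q by rewrite expn_gt0.
    by rewrite /B ltn_add2l; move: hm q0; clear; lia.
  by rewrite -[X in _ < X]addn0; apply: letter_lt => //; exact: ltnW.
pose vert (x : nat * L) := at_ x.1 x.
have F_vert j x y z : x \in pts j -> y \in pts j -> z \in pts j ->
    F x y z = edge (edges G) (vert x) (vert y) (vert z).
  move=> /valid[xB _] /valid[yB _] /valid[zB _].
  by rewrite /vert /at_ w2.
have vert_uniq j : uniq (map vert (pts j)).
  rewrite map_inj_in_uniq // => -[i [p a]] [i' [p' a']] /valid[/= iB an] /valid[/= iB' an'].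
  by move=> eqw; have [/= -> -> ->] := w1 i i' p p' a a' iB iB' an an' eqw.
pose S j := [set v in map vert (pts j)].
have cardS j : #|S j| = m.
  by rewrite cardsE (card_uniqP (vert_uniq j)) size_map size_pts.
have edgesS j : (6 * num_edges G (S j))%:R%R = edge_sum F (pts j).
  rewrite -sum_triples; last exact: edges_card3.
  rewrite /edge_sum /triple_sum sum_set_seq // big_map natr_sum; apply: eq_big_seq => x xp.
  rewrite sum_set_seq // big_map natr_sum; apply: eq_big_seq => y yp.
  rewrite sum_set_seq // big_map natr_sum; apply: eq_big_seq => z zp.
  by rewrite (F_vert j).
set cb := alt_sum _ in nz.
have diff j : j < 2 ^ (3 * q) ->
    ((6 * num_edges G (S 0%N))%N%:R - (6 * num_edges G (S j))%N%:R = 12 * cb * j%:R :> int)%R.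
  move=> jq; rewrite !edgesS (@digits_sum _ F F12 F23 Find _ _ _ _ _ _ _ _ _ m _ hom q) //.
  - by rewrite expn0 mul1n.
  1-3: by move=> b; apply: p6.
have injS j j' : j < 2 ^ (3 * q) -> j' < 2 ^ (3 * q) ->
    num_edges G (S j) = num_edges G (S j') -> j = j'.
  move=> jq j'q eqe; have := diff j jq; rewrite eqe diff //.
  by move/(mulfI _) => /(_ _)/eqP; rewrite eqr_nat => h; apply/eqP; rewrite eq_sym h // mulf_neq0.
pose phi (j : 'I_(2 ^ (3 * q))) : 'I_('C(m, 3)).+1 := inord (num_edges G (S j)).
have le_m j : num_edges G (S j) < ('C(m, 3)).+1 by rewrite ltnS -(cardS j) num_edges_le.
have phi_inj : injective phi.
  move=> j j' /(congr1 val); rewrite /= !inordK // => /injS h.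
  by apply: val_inj; apply: h.
rewrite -[X in X <= _]card_ord -(card_imset _ phi_inj); apply: subset_leq_card.
apply/subsetP => f /imsetP[j _ ->]; rewrite inE; apply/existsP; exists (S j).
by rewrite /mf_subset cardS eqxx /= inordK.
Qed.

(** * Sets of extreme density *)

Local Open Scope ring_scope.

(** The edges, or the triples that are not edges. *)
Definition three_sets (V : finType) (G : three_graph V) (b : bool) : {set {set V}} :=
  [set e : {set V} | (#|e| == 3) && ((e \in edges G) == b)].

Lemma card_three_sets (V : finType) (G : three_graph V) (W : {set V}) b :
  #|[set e in three_sets G b | e \subset W]| =
  if b then num_edges G W else ('C(#|W|, 3) - num_edges G W)%N.
Proof.
have eT : [set e in three_sets G true | e \subset W] = [set e in edges G | e \subset W].
  apply/setP => e; rewrite !inE eqb_id; case eG: (e \in edges G); rewrite ?andbF //.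
  by rewrite (edges_card3 eG) eqxx.
case: b; first by rewrite eT.
suff -> : 'C(#|W|, 3) = (num_edges G W + #|[set e in three_sets G false | e \subset W]|)%N.
  by rewrite addKn.
rewrite -cards_draws -(cardsID [set e in edges G | e \subset W] [set e : {set V} | _ & _]).
congr (_ + _)%N.
  apply: eq_card => e; rewrite !inE.
  by case eG: (e \in edges G); rewrite ?andbF // (edges_card3 eG) eqxx andbT andbb.
apply: eq_card => e; rewrite !inE eqbF_neg.
by case: (e \subset W); case: (e \in edges G); case: (#|e| == 3%N).
Qed.

Lemma tripartite_labels (V : finType) (E : {set {set V}}) t (W T1 T2 T3 : {set V}) :
  T1 \subset W -> T2 \subset W -> T3 \subset W ->
  #|T1| = t -> #|T2| = t -> #|T3| = t ->
  (forall x y z, x \in T1 -> y \in T2 -> z \in T3 ->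
     #|[set x; y; z]| = 3 /\ [set x; y; z] \in E) ->
  exists T : 'I_3 * 'I_t -> V, [/\ injective T, forall l, T l \in W &
    forall x y z, [set T (0, x); T (1, y); T (2%:R, z)] \in E].
Proof.
move=> W1 W2 W3 c1 c2 c3 H.
pose f1 (x : 'I_t) := enum_val (cast_ord (esym c1) x).
pose f2 (x : 'I_t) := enum_val (cast_ord (esym c2) x).
pose f3 (x : 'I_t) := enum_val (cast_ord (esym c3) x).
have i1 : injective f1 by move=> x y /enum_val_inj /cast_ord_inj.
have i2 : injective f2 by move=> x y /enum_val_inj /cast_ord_inj.
have i3 : injective f3 by move=> x y /enum_val_inj /cast_ord_inj.
have m1 x : f1 x \in T1 by exact: enum_valP.
have m2 x : f2 x \in T2 by exact: enum_valP.
have m3 x : f3 x \in T3 by exact: enum_valP.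
have ne x y z : [/\ f1 x != f2 y, f1 x != f3 z & f2 y != f3 z].
  by apply/cards3; have [] := H _ _ _ (m1 x) (m2 y) (m3 z).
pose T (l : 'I_3 * 'I_t) := if l.1 == 0 then f1 l.2 else if l.1 == 1 then f2 l.2 else f3 l.2.
exists T; split; last by move=> x y z; have [] := H _ _ _ (m1 x) (m2 y) (m3 z).
  have ord3 (j : 'I_3) : [\/ j = 0, j = 1 | j = 2%:R].
    case: j => -[|[|[|]]] //= lt; [apply: Or31|apply: Or32|apply: Or33]; exact: val_inj.
  move=> [j x] [j' x']; rewrite /T /=.
  have [n12 n13 n23] := ne x x x'; have [n12' n13' n23'] := ne x x' x'.
  have [k12 k13 k23] := ne x' x x; have [k12' k13' k23'] := ne x' x' x.
  case: (ord3 j) => ->; case: (ord3 j') => -> /=.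
  - by move/i1 => ->.
  - by move/eqP; rewrite (negPf n12').
  - by move/eqP; rewrite (negPf n13).
  - by move/eqP; rewrite eq_sym (negPf k12).
  - by move/i2 => ->.
  - by move/eqP; rewrite (negPf n23).
  - by move/eqP; rewrite eq_sym (negPf k13).
  - by move/eqP; rewrite eq_sym (negPf k23').
  - by move/i3 => ->.
move=> [j x]; rewrite /T /=.
by case: ifP => _; [apply: (subsetP W1) | case: ifP => _; [apply: (subsetP W2) | apply: (subsetP W3)]].
Qed.

(** [kst3] is applied to the edges and to the non-edges of a set [W]: each of the
    two families contains a proportion [g] of the triples of [W], hence at least
    [g ^ 2 * #|W| ^ 3] ordered triples. *)
Lemma dense_rich t : exists C : nat, forall (R : realFieldType) (g : R) (V : finType)
    (G : three_graph V) (N : nat),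
  0 < g -> g <= 2^-1 -> 1 <= g ^+ C * N%:R ->
  (forall S : {set V}, (N <= #|S|)%N ->
     g * ('C(#|S|, 3))%:R < (num_edges G S)%:R < (1 - g) * ('C(#|S|, 3))%:R) ->
  rich (edges G) t N.
Proof.
have [C0 HC] := kst3 t; exists (C0 + 3)%N => R g V G N g0 gh bigN bad b W NW.
have g1 : g <= 1 by lra.
set w := #|W|; have Nw : N%:R <= w%:R :> R by rewrite ler_nat.
have gC k : (k <= C0 + 3)%N -> 1 <= g ^+ k * w%:R.
  move=> kC; apply: le_trans bigN _; apply: ler_pM => //; first by rewrite exprn_ge0 // ltW.
  by apply: ler_wiXn2l => //; exact: ltW.
have w8 : 8 <= w%:R :> R.
  have := gC 3 (leq_addl _ _).
  have : g ^+ 3 <= 8^-1.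
    apply: (@le_trans _ _ (2^-1 ^+ 3)); last by lra.
    by apply: lerXn2r; rewrite ?nnegrE ?invr_ge0 ?ler0n // ltW.
  have : 0 <= w%:R :> R by [].
  by move: (g ^+ 3) => x; nra.
have binw : 6 * ('C(w, 3))%:R = w%:R * (w%:R - 1) * (w%:R - 2) :> R.
  have w2 : (2 <= w)%N by rewrite -(ler_nat R); lra.
  have e1 : w%:R - 1 = w.-1%:R :> R by rewrite -subn1 natrB // ltnW.
  have e2 : w%:R - 2 = w.-2%:R :> R by rewrite -subn2 natrB.
  rewrite e1 e2 -!natrM; congr _%:R.
  by have := bin_ffact w 3; rewrite mulnC !ffactnS ffactn0 muln1 mulnA.
have [T1 [T2 [T3 [[s1 s2 s3] [c1 c2 c3] H]]]] : exists T1 T2 T3 : {set V},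
  [/\ [/\ T1 \subset W, T2 \subset W & T3 \subset W],
      [/\ #|T1| = t, #|T2| = t & #|T3| = t] &
      forall x y z, x \in T1 -> y \in T2 -> z \in T3 -> [set x; y; z] \in three_sets G b].
  apply: (HC R g V (fun x y z => [set x; y; z] \in three_sets G b) W g0 gh).
    exact: gC (leq_addr _ _).
  rewrite sum_triples; last by move=> e; rewrite inE => /andP[/eqP].
  rewrite card_three_sets natrM.
  have le : g * ('C(w, 3))%:R <= (if b then num_edges G W else ('C(#|W|, 3) - num_edges G W)%N)%:R.
    have /andP[lo hi] := bad W NW; case: b; first exact: ltW.
    by rewrite natrB ?num_edges_le //; move: lo hi; rewrite -/w; lra.
  apply: (@le_trans _ _ (6 * (g * ('C(w, 3))%:R))); last by apply: ler_wpM2l.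
  rewrite [X in _ <= X]mulrCA binw expr2 -mulrA; apply: ler_wpM2l; first exact: ltW.
  apply: (@le_trans _ _ (2^-1 * w%:R ^+ 3)); first by apply: ler_wpM2r => //; exact: exprn_ge0.
  by move: (w%:R : R) w8 => x x8; nra.
have H3 x y z : x \in T1 -> y \in T2 -> z \in T3 ->
    #|[set x; y; z]| = 3%N /\ [set x; y; z] \in three_sets G b.
  move=> xT yT zT; have h := H x y z xT yT zT.
  by split => //; move: h; rewrite inE => /andP[/eqP].
have [T [injT TW TE]] := tripartite_labels s1 s2 s3 c1 c2 c3 H3.
exists T; split => // x y z; have := TE x y z; rewrite inE => /andP[_ /eqP]; exact.
Qed.

(** The least [q] with [m <= 192 * 2 ^ q]; it is 0 for small [m], where a single
    size is enough. *)
Lemma scale_exists m : (0 < m)%N -> exists q,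
  [/\ (2 ^ q <= m)%N, (96 * 2 ^ q <= m + 96)%N & (m <= 192 * 2 ^ q)%N].
Proof.
move=> m0; have ex : exists q, (m <= 192 * 2 ^ q)%N.
  by exists m; apply: leq_trans (leq_pmull _ _) => //; apply: ltnW; exact: ltn_expl.
case: (ex_minnP ex) => -[|q] le min; first by exists 0%N; split => //; lia.
exists q.+1; have lt : (192 * 2 ^ q < m)%N by rewrite ltnNge; apply/negP => /min; rewrite ltnn.
by split => //; rewrite expnS; lia.
Qed.

Lemma small_set (V : finType) : exists S : {set V}, #|S| = minn #|V| 2.
Proof.
have /card_gt0P [S] : (0 < #|[set S : {set V} | S \subset setT & #|S| == minn #|V| 2]|)%N.
  by rewrite cards_draws cardsT bin_gt0 geq_minl.
by rewrite inE => /andP[_ /eqP]; exists S.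
Qed.

Theorem mainTheorem4 (R : realType) :
  exists c : R, 0 < c /\
    forall m : nat, (3 <= m)%N ->
    exists K : R,
    forall gamma : R, 0 < gamma -> gamma <= 1 ->
    forall (V : finType) (G : three_graph V),
      (num_sizes G m)%:R < c * m%:R ^+ 3 ->
      exists S : {set V},
        gamma `^ K * #|V|%:R <= #|S|%:R /\
        (density_le G S gamma \/ density_ge G S (1 - gamma)).
Proof.
exists (192 ^- 3); split; first by rewrite invr_gt0 exprn_gt0.
move=> m m3; have [q [qm cost mq]] := scale_exists (ltnW (ltnW m3)).
have [t [A many]] := many_sizes m3 qm cost.
have [C dense] := dense_rich t.
(* [A] pays for the blocks and [C] for the patterns inside them; the extra 1
   absorbs the factor 2 lost in the integer quotient [N] below. *)
pose k := (A + C + 1)%N; exists k%:R => g g0 g1 V G few.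
rewrite powR_mulrn; last exact: ltW.
have V0 : 0 <= #|V|%:R :> R by [].
have gk1 j : g ^+ j <= 1 by apply: exprn_ile1 => //; exact: ltW.
have [gh|gh] := lerP g 2^-1; last first.
  exists setT; split; first by rewrite cardsT ler_piMl.
  rewrite /density_le /density_ge.
  have [le|lt] := lerP (num_edges G setT)%:R (g * ('C(#|[set: V]|, 3))%:R); first by left.
  right; apply: le_trans (ltW lt); apply: ler_wpM2r => //; lra.
have [le2|gt2] := lerP (g ^+ k * #|V|%:R) 2.
  have [S cS] := small_set V; exists S; split; last first.
    left; rewrite /density_le (_ : num_edges G S = 0%N) ?mulr_ge0 // ?ltW //.
    apply/eqP; rewrite -leqn0; apply: leq_trans (num_edges_le _ _) _.
    by rewrite bin_small // cS ltnS geq_minr.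
  rewrite cS; case: (leqP #|V| 2) => V2; last exact: le2.
  by rewrite ler_piMl.
case: (boolP [exists S : {set V}, (g ^+ k * #|V|%:R <= #|S|%:R) &&
  (((num_edges G S)%:R <= g * ('C(#|S|, 3))%:R) ||
   ((1 - g) * ('C(#|S|, 3))%:R <= (num_edges G S)%:R))]).
  case/existsP => S /andP[big /orP[lo|hi]]; exists S; split => //; first by left.
  by right.
move=> none; exfalso.
pose N := (#|V| %/ A.+1)%N.
have gA j : g ^+ j * j.+1%:R <= 1 by exact: expr_natr_le1.
have kE : g ^+ k = g ^+ A.+1 * g ^+ C by rewrite -exprD /k addn1 addSn.
have gkA : g ^+ k <= g ^+ A.+1.
  by rewrite kE ler_piMr // exprn_ge0 // ltW.
have AV : A.+1%:R < #|V|%:R :> R.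
  have h : g ^+ A.+1 * A.+1%:R <= 1.
    rewrite exprS -mulrA; apply: mulr_ile1 => //; first exact: ltW.
    by rewrite mulr_ge0 // exprn_ge0 // ltW.
  have gt0 : 0 < g ^+ A.+1 by rewrite exprn_gt0.
  rewrite -(ltr_pM2l gt0); apply: le_lt_trans h _.
  by apply: lt_le_trans (le_trans (ltW gt2) (ler_wpM2r V0 gkA)); rewrite ltr1n.
have N0 : (0 < N)%N by rewrite /N divn_gt0 // -(ler_nat R) ltW.
have NV : g ^+ A.+1 * #|V|%:R <= N%:R.
  have lt : (#|V| <= 2 * A.+1 * N)%N.
    by have := ltn_ceil #|V| (ltn0Sn A); rewrite -/N; move: N0; nia.
  have lt' : #|V|%:R <= 2 * A.+1%:R * N%:R :> R by rewrite -!natrM ler_nat.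
  have h2 : g ^+ A.+1 * (2 * A.+1%:R) <= 1.
    rewrite exprS mulrACA; apply: mulr_ile1 => //; last by lra.
      by rewrite mulr_ge0 // ltW.
    by rewrite mulr_ge0 // exprn_ge0 // ltW.
  apply: (@le_trans _ _ (g ^+ A.+1 * (2 * A.+1%:R) * N%:R)); last by rewrite ler_piMl.
  by rewrite -mulrA ler_wpM2l // exprn_ge0 // ltW.
have rch : rich (edges G) t N.
  apply: (dense R g V G N g0 gh) => [|S NS].
    apply: (@le_trans _ _ (g ^+ k * #|V|%:R)); first by apply: ltW; apply: lt_trans gt2; lra.
    by rewrite kE [_ * g ^+ C]mulrC -mulrA ler_wpM2l // exprn_ge0 // ltW.
  have big : g ^+ k * #|V|%:R <= #|S|%:R.
    apply: le_trans (le_trans NV _); first by apply: ler_wpM2r.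
    by rewrite ler_nat.
  move: none; rewrite negb_exists => /forallP /(_ S).
  by rewrite big /= negb_or -!ltNge.
have AN : (A * N <= #|V|)%N.
  apply: leq_trans (leq_trunc_div #|V| A.+1); rewrite mulnC leq_mul2l; apply/orP; right; exact: leqnSn.
have := many V G N N0 rch AN; rewrite -(ler_nat R) => /le_lt_trans /(_ few).
rewrite ltNge; case/negP.
rewrite mulrC ler_pdivrMr ?exprn_gt0 //.
apply: (@le_trans _ _ ((192 * 2 ^ q)%:R ^+ 3)).
  by apply: lerXn2r; rewrite ?nnegrE ?ler0n // ler_nat.
by rewrite -!natrX -!natrM ler_nat expnMn mulnC expnAC -expnM leq_mul2r [(3 * q)%N]mulnC leqnn orbT.
Qed.
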